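(* Let $\mathcal V\to S$ be a variation of graded-polarized mixed Hodge structure over a complex manifold $S$, with Hodge filtration $\mathcal F$, weight filtration $\mathcal W$ and Gauss--Manin connection $\nabla$. Let $\{\mathcal U^p\}$ denote the collection of $C^\infty$ subbundles of $\mathcal V$ defined by $$\mathcal U^p_s=\bigoplus_q I^{p,q}_{(\mathcal F_s,\mathcal W_s)},\qquad s\in S .$$ Then, relative to $\nabla$, the direct sum decomposition $\mathcal V=\bigoplus_p\mathcal U^p$ defines an (unpolarized) complex variation of Hodge structure.
   Context: A variation of graded-polarized mixed Hodge structure $\mathcal V\to S$ over a complex manifold $S$ is a $\mathbb Q$-local system $\mathcal V_{\mathbb Q}$ of finite rank on $S$ with: (1) a rational (flat) increasing weight filtration $\mathcal W_k$ of $\mathcal V_{\mathbb C}=\mathcal V_{\mathbb Q}\otimes\mathbb C$; (2) a decreasing Hodge filtration $\mathcal F^p$ of $\mathcal V_{\mathbb C}\otimes\mathcal O_S$ by holomorphic subbundles; (3) rational non-degenerate (flat) bilinear forms $\mathcal S_k:Gr^{\mathcal W}_k(\mathcal V_{\mathbb Q})\otimes Gr^{\mathcal W}_k(\mathcal V_{\mathbb Q})\to\mathbb Q$ of parity $(-1)^k$; such that (a) $\nabla\mathcal F^p\subseteq\Omega^1_S\otimes\mathcal F^{p-1}$ for the Gauss--Manin (flat) connection $\nabla$ and all $p$, and (b) for each $k$ the triple $(Gr^{\mathcal W}_k(\mathcal V_{\mathbb Q}),\mathcal F Gr^{\mathcal W}_k,\mathcal S_k)$ is a variation of pure, polarized Hodge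 structure of weight $k$. Deligne bigrading: a mixed Hodge structure $(F,W)$ on $V=V_{\mathbb Q}\otimes\mathbb C$ determines a unique decomposition $V=\bigoplus_{p,q}I^{p,q}_{(F,W)}$ with $F^p=\bigoplus_{r\ge p,s}I^{r,s}$, $W_k=\bigoplus_{r+s\le k}I^{r,s}$ and $\overline{I^{p,q}}=I^{q,p}\bmod\bigoplus_{r<q,\,s<p}I^{r,s}$. A complex variation of Hodge structure is a flat complex vector bundle $(E,\nabla)$ with a $C^\infty$ decomposition $E=\bigoplus_p\mathcal U^p$ such that $$\nabla:\mathcal E^0(\mathcal U^p)\to\mathcal E^{0,1}(\mathcal U^{p+1})\oplus\mathcal E^{0,1}(\mathcal U^p)\oplus\mathcal E^{1,0}(\mathcal U^p)\oplus\mathcal E^{1,0}(\mathcal U^{p-1})$$ for every $p$, where $\mathcal E^0$ and $\mathcal E^{a,b}$ denote smooth sections and smooth $(a,b)$-forms with values in the bundle. Here it is applied to the $C^\infty$ vector bundle underlying $\mathcal V$. *)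

(* Defs.v *)
From HB Require Import structures.
From mathcomp Require Import all_boot all_order all_algebra.
From mathcomp Require Import complex.
From mathcomp Require Import all_classical all_reals all_analysis.
Set Implicit Arguments.
Unset Strict Implicit.
Unset Printing Implicit Defensive.
Import Order.TTheory GRing.Theory Num.Theory numFieldNormedType.Exports.
Local Open Scope classical_set_scope.
Local Open Scope ring_scope.

(* R[i] packaged as a numClosedFieldType, so that it (and row vectors over it)
   receive the topology of a numFieldType. *)
Definition Cx (R : realType) : numClosedFieldType := R[i].

(** * Linear algebra *)

(* For a field morphism f, the L-span of the image of U under f: with f = ratr
   it is the complexification of a rational subspace, with f = conjugation the
   complex conjugate of a complex subspace. *)
Definition ext_space (K L : fieldType) (f : K -> L) (n : nat)
    (U : {vspace 'rV[K]_n}) : {vspace 'rV[L]_n} :=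
  <<[seq map_mx f u | u <- vbasis U]>>%VS.

Definition complexify (R : realType) (n : nat) (U : {vspace 'rV[rat]_n}) :
  {vspace 'rV[Cx R]_n} := ext_space ratr U.

Definition conj_space (R : realType) (n : nat) (U : {vspace 'rV[Cx R]_n}) :
  {vspace 'rV[Cx R]_n} := ext_space Num.conj U.

Definition bilin (K : fieldType) (n : nat) (Q : 'M[K]_n) (u v : 'rV[K]_n) : K :=
  (u *m Q *m v^T) 0 0.

Definition direct_decomposition (K : fieldType) (E : vectType K)
    (T : choiceType) (U : T -> {vspace E}) : Prop :=
  exists s : seq T,
    [/\ uniq s, forall t, t \notin s -> U t = 0%VS,
        directv (\sum_(t <- s) U t) & (\sum_(t <- s) U t)%VS = fullv].

(* Sum of a finitely supported family of subspaces. *)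
Definition sum_over (K : fieldType) (E : vectType K) (T : choiceType)
    (A : set T) (U : T -> {vspace E}) : {vspace E} :=
  \big[addv/0%VS]_(t \in A) U t.

(* [W' <= W] are rational subspaces of Q^n, and subspaces of the quotient W/W'
   are encoded by their preimages in W. The family G is (the preimage of) a
   finite decreasing filtration of (W/W') (x) C, and the last two conditions say
   that (W/W') (x) C is the direct sum of G^p and of the conjugate of
   G^(k-p+1). *)
Definition pure_hodge (R : realType) (n : nat) (k : int)
    (W' W : {vspace 'rV[rat]_n}) (G : int -> {vspace 'rV[Cx R]_n}) : Prop :=
  [/\ forall p, (G (p + 1)%R <= G p)%VS,
      exists a b, G a = complexify R W /\ G b = complexify R W',
      forall p, (complexify R W' <= G p <= complexify R W)%VS,
      forall p, (G p + conj_space (G (k - p + 1)%R))%VS = complexify R W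
    & forall p, (G p :&: conj_space (G (k - p + 1)%R))%VS = complexify R W'].

(* The matrix Q stands for a bilinear form on W/W' : only its values on W are
   relevant, and W' lies in the radical of its restriction to W. *)
Definition polarization (R : realType) (n : nat) (k : int)
    (W' W : {vspace 'rV[rat]_n}) (G : int -> {vspace 'rV[Cx R]_n})
    (Q : 'M[rat]_n) : Prop :=
  [/\ forall u v, u \in W -> v \in W -> bilin Q u v = (-1) ^ k * bilin Q v u,
      forall u, u \in W ->
        (u \in W') <-> (forall v, v \in W -> bilin Q u v = 0),
      forall p u v, u \in G p -> v \in G (k - p + 1) ->
        bilin (map_mx ratr Q) u v = 0
    & forall p q u, p + q = k -> u \in G p -> u \in conj_space (G q) ->
        u \notin complexify R W' ->
        0 < ('i : Cx R) ^ (p - q) *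
            bilin (map_mx ratr Q) u (map_mx Num.conj u)].

(* When (F, W) is a mixed Hodge structure, there is exactly one such I. *)
Definition deligne_bigrading (R : realType) (n : nat)
    (F : int -> {vspace 'rV[Cx R]_n}) (W : int -> {vspace 'rV[rat]_n})
    (I : int * int -> {vspace 'rV[Cx R]_n}) : Prop :=
  [/\ direct_decomposition I,
      forall p, F p = sum_over [set x | p <= x.1] I,
      forall k, complexify R (W k) = sum_over [set x | x.1 + x.2 <= k] I
    & forall p q,
        let J := sum_over [set x | x.1 < q /\ x.2 < p] I in
        (conj_space (I (p, q)) + J)%VS = (I (q, p) + J)%VS].

(** * Functions on open subsets of C^n *)

Section Calculus.
Variables (R : realType) (n : nat).
Local Notation C := (Cx R).
Implicit Types (f : 'rV[C]_n -> C) (U : set 'rV[C]_n).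

Definition line_at f (x v : 'rV[C]_n) : R -> C :=
  fun t => f (x + (t%:C)%C *: v).

(* Derivative at x along v, for the underlying real structure of C^n. *)
Definition has_rderive f x v : Prop :=
  derivable (fun t => complex.Re (line_at f x v t)) 0 1 /\
  derivable (fun t => complex.Im (line_at f x v t)) 0 1.

Definition rderive v f x : C :=
  Complex (derive1 (fun t => complex.Re (line_at f x v t)) 0)
          (derive1 (fun t => complex.Im (line_at f x v t)) 0).

(* Continuous iterated derivatives along all real directions, up to order k. *)
Fixpoint Ck_on (k : nat) U f : Prop :=
  (forall x, U x -> {for x, continuous f}) /\
  (if k is k'.+1 then
     forall v, (forall x, U x -> has_rderive f x v) /\ Ck_on k' U (rderive v f)
   else True).

Definition smooth_on U f : Prop := forall k, Ck_on k U f.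

(* The value on the tangent vector v of the (0,1)-part of df. *)
Definition dbar v f x : C :=
  2^-1 * (rderive v f x + 'i * rderive ('i *: v) f x).

(* Holomorphic functions of several variables as the smooth solutions of the
   Cauchy-Riemann equations. *)
Definition holomorphic_on U f : Prop :=
  smooth_on U f /\ forall x v, U x -> dbar v f x = 0.

End Calculus.

(** * Complex manifolds and local systems *)

(* The connected components may have different dimensions. The values of
   [coord c] outside [cdom c], and of [coordV c] outside its image, are
   irrelevant. *)
Record complex_manifold (R : realType) (S : topologicalType) :=
  ComplexManifold {
  mfd_hausdorff : hausdorff_space S;
  mfd_second_countable : @second_countable S;
  chart : Type;
  cdim : chart -> nat;
  cdom : chart -> set S;
  coord : forall c, S -> 'rV[Cx R]_(cdim c);
  coordV : forall c, 'rV[Cx R]_(cdim c) -> S;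
  cdom_open : forall c, open (cdom c);
  cdom_cover : forall s, exists c, cdom c s;
  cimg_open : forall c, open (coord c @` cdom c);
  coordK : forall c s, cdom c s -> coordV (coord c s) = s;
  coord_continuous : forall c s, cdom c s -> {for s, continuous (coord c)};
  coordV_continuous : forall c x, (coord c @` cdom c) x ->
    {for x, continuous (@coordV c)};
  transition_holomorphic : forall c c' (j : 'I_(cdim c')),
    holomorphic_on (coord c @` (cdom c `&` cdom c'))
      (fun x => coord c' (coordV x) 0 j)
}.

(* A Q-local system of finite rank. A basis of every fibre has been chosen
   (pointwise, with no relation between different points), so that the fibre at
   s is Q^(lrank s), whose elements are row vectors. For s in the neighbourhood
   [lnbhd s0] of s0, right multiplication by [ltr s0 s] is the parallel
   transport from the fibre at s to the fibre at s0: it trivializes the local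
   system over [lnbhd s0]. *)
Record local_system (S : topologicalType) := LocalSystem {
  lrank : S -> nat;
  lnbhd : S -> set S;
  ltr : forall s0 s, 'M[rat]_(lrank s, lrank s0);
  lnbhd_open : forall s0, open (lnbhd s0);
  lnbhd_refl : forall s0, lnbhd s0 s0;
  ltr_refl : forall s, ltr s s = 1%:M;
  ltr_inv : forall s0 s, lnbhd s0 s ->
    exists N, ltr s0 s *m N = 1%:M /\ N *m ltr s0 s = 1%:M;
  ltr_locally_constant : forall s0 s1 s, lnbhd s0 s -> lnbhd s1 s ->
    exists A : 'M[rat]_(lrank s0, lrank s1),
      \forall t \near s, ltr s1 t = ltr s0 t *m A
}.

Section Bundles.
Variables (R : realType) (S : topologicalType).
Variables (M : complex_manifold R S) (V : local_system S).
Local Notation C := (Cx R).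

(* Sections of V (x) C, families of subspaces of the fibres of V, resp. of
   V (x) C. *)
Definition bsection := forall s, 'rV[C]_(lrank V s).
Definition Qfamily := forall s, {vspace 'rV[rat]_(lrank V s)}.
Definition Cfamily := forall s, {vspace 'rV[C]_(lrank V s)}.

(* The section sigma in the chart c and the flat trivialization around s0. *)
Definition local_expr (c : chart M) (s0 : S) (sigma : bsection)
    (x : 'rV[C]_(cdim c)) : 'rV[C]_(lrank V s0) :=
  sigma (coordV x) *m map_mx ratr (ltr V s0 (coordV x)).

Definition smooth_section (O : set S) (sigma : bsection) : Prop :=
  forall (c : chart M) s0 (j : 'I_(lrank V s0)),
    smooth_on (coord c @` (O `&` cdom c `&` lnbhd V s0))
      (fun x => local_expr s0 sigma x 0 j).

Definition holomorphic_section (O : set S) (sigma : bsection) : Prop :=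
  forall (c : chart M) s0 (j : 'I_(lrank V s0)),
    holomorphic_on (coord c @` (O `&` cdom c `&` lnbhd V s0))
      (fun x => local_expr s0 sigma x 0 j).

Definition subbundle (regular : set S -> bsection -> Prop) (B : Cfamily) :
    Prop :=
  forall s0, exists (N : set S) (m : nat) (e : 'I_m -> bsection),
    [/\ open N, N s0, forall i, regular N (e i)
      & forall s, N s -> basis_of (B s) [seq e i s | i <- enum 'I_m]].

Definition smooth_subbundle := subbundle smooth_section.
Definition holomorphic_subbundle := subbundle holomorphic_section.

Definition flat_family (W : Qfamily) : Prop :=
  forall s0, \forall s \near s0, (linfun (mulmxr (ltr V s0 s)) @: W s)%VS = W s0.

(* A V-valued complex 1-form. The real tangent space at s is identified with
   C^(cdim c) by each chart c around s, and [omega c s v] is the value on the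
   tangent vector with coordinates v. *)
Definition one_form :=
  forall (c : chart M) s, 'rV[C]_(cdim c) -> 'rV[C]_(lrank V s).

Definition tangent_transition (c c' : chart M) (s : S) (v : 'rV[C]_(cdim c)) :
    'rV[C]_(cdim c') :=
  \row_j rderive v (fun x => coord c' (coordV x) 0 j) (coord c s).

Definition form_in (tau : C -> C) (regular : set S -> bsection -> Prop)
    (O : set S) (B : Cfamily) (omega : one_form) : Prop :=
  [/\ forall c c' s v, O s -> cdom c s -> cdom c' s ->
        omega c' s (tangent_transition c' s v) = omega c s v,
      forall c s a u v, O s -> cdom c s ->
        omega c s (a *: u + v) = tau a *: omega c s u + omega c s v,
      forall c v, regular (O `&` cdom c) (fun s => omega c s v)
    & forall c s v, O s -> cdom c s -> omega c s v \in B s].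

(* Over O: smooth (1,0)-forms, smooth (0,1)-forms and holomorphic 1-forms with
   values in B. *)
Definition form10 := form_in id smooth_section.
Definition form01 := form_in Num.conj smooth_section.
Definition Omega1 := form_in id holomorphic_section.

(* The Gauss-Manin connection, whose flat sections are those that are locally
   constant in the flat trivializations. It is computed at s in the
   trivialization around s, which is the identity at s. *)
Definition nabla (sigma : bsection) : one_form := fun c s v =>
  \row_j rderive v (fun x => local_expr s sigma x 0 j) (coord c s).

Definition griffiths_transverse (F : int -> Cfamily) : Prop :=
  forall p (O : set S) sigma, open O -> holomorphic_section O sigma ->
    (forall s, O s -> sigma s \in F p s) ->
    Omega1 O (F (p - 1)) (nabla sigma).

(* G encodes a filtration of (W/W') (x) C as in [pure_hodge]; such a filtration
   is by holomorphic subbundles of W/W', resp. satisfies transversality for the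
   connection of W/W', iff the preimages in V do. *)
Definition polarized_vhs (k : int) (W' W : Qfamily) (G : int -> Cfamily)
    (Q : forall s, 'M[rat]_(lrank V s)) : Prop :=
  [/\ forall p, holomorphic_subbundle (G p),
      griffiths_transverse G,
      forall s, pure_hodge k (W' s) (W s) (G^~ s),
      forall s0, \forall s \near s0, forall u v, u \in W s -> v \in W s ->
        bilin (Q s0) (u *m ltr V s0 s) (v *m ltr V s0 s) = bilin (Q s) u v
    & forall s, polarization k (W' s) (W s) (G^~ s) (Q s)].

Definition complex_vhs (U : int -> Cfamily) : Prop :=
  [/\ forall p, smooth_subbundle (U p),
      forall s, direct_decomposition (U^~ s)
    & forall p (O : set S) sigma, open O -> smooth_section O sigma ->
        (forall s, O s -> sigma s \in U p s) ->
        exists a b g d : one_form,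
          [/\ form01 O (U (p + 1)) a, form01 O (U p) b,
              form10 O (U p) g, form10 O (U (p - 1)) d
            & forall c s v, O s -> cdom c s ->
                nabla sigma s v =
                  a c s v + b c s v + g c s v + d c s v :> 'rV[C]_(lrank V s)]].

End Bundles.

(* The filtration induced by F on Gr^W_k, encoded by preimages in W_k. *)
Definition gr_filtration (R : realType) (n : nat)
    (F : int -> {vspace 'rV[Cx R]_n}) (W : int -> {vspace 'rV[rat]_n})
    (k p : int) : {vspace 'rV[Cx R]_n} :=
  (F p :&: complexify R (W k) + complexify R (W (k - 1)%R))%VS.

Record gp_vmhs (R : realType) (S : topologicalType)
    (M : complex_manifold R S) := GpVmhs {
  vls : local_system S;
  wfil : int -> Qfamily vls;
  hfil : int -> Cfamily R vls;
  gform : int -> forall s, 'M[rat]_(lrank vls s);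
  wfil_flat : forall k, flat_family (wfil k);
  wfil_increasing : forall k s, (wfil k s <= wfil (k + 1)%R s)%VS;
  wfil_finite : forall s, exists a b, wfil a s = 0%VS /\ wfil b s = fullv;
  hfil_holomorphic : forall p, holomorphic_subbundle M (hfil p);
  hfil_decreasing : forall p s, (hfil (p + 1)%R s <= hfil p s)%VS;
  hfil_finite : forall s, exists a b, hfil a s = fullv /\ hfil b s = 0%VS;
  hfil_transverse : griffiths_transverse M hfil;
  gr_polarized_vhs : forall k,
    polarized_vhs M k (wfil (k - 1)) (wfil k)
      (fun p s => gr_filtration (hfil^~ s) (wfil^~ s) k p) (gform k)
}.

(* Main.v *)
Require Import Defs.
From HB Require Import structures.
From mathcomp Require Import all_boot all_order all_algebra.
From mathcomp Require Import complex ring zify.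
From mathcomp Require Import all_classical all_reals all_analysis.
Set Implicit Arguments.
Unset Strict Implicit.
Unset Printing Implicit Defensive.
Import Order.TTheory GRing.Theory Num.Theory numFieldNormedType.Exports.
Local Open Scope classical_set_scope.
Local Open Scope ring_scope.

(** Write U^p for the p-th summand of the decomposition, and
    Phi_p = \bigoplus_(r <= p) U^r, so that U^p = F^p \cap Phi_p and V is the
    direct sum of F^(p+1) and Phi_p.

    The connection on F is understood by hypothesis: F^p is spanned by holomorphic
    sections, and by transversality the (1,0)-part of nabla maps smooth sections
    of F^p into F^(p-1), while the (0,1)-part preserves F^p ([deriv_F]).
    The connection on Phi is obtained from it by complex conjugation. The
    congruence satisfied by the conjugates of the I^(p,q) shows that Phi_p is the
    sum of the conjugates of the F^r \cap W_k with k - r <= p ([conj_FW_Phi] and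
    [Phi_ind]). Conjugation commutes with nabla and exchanges the types (1,0) and
    (0,1), and nabla preserves the flat family W_k; hence the (1,0)-part of nabla
    preserves Phi_p and its (0,1)-part maps Phi_p to Phi_(p+1) ([spanned_Phi]).
    For a section of U^p the (0,1)-part thus lies in
    F^p \cap Phi_(p+1) = U^p + U^(p+1), and the (1,0)-part in
    F^(p-1) \cap Phi_p = U^(p-1) + U^p ([deriv_U]). Projecting to the summands
    gives the four forms.

    What remains is that all these families vary smoothly. The preimages of the
    Gr_k F^p are bundles, so a dimension count shows that F^p \cap W_k has locally
    constant rank ([dim_FW]). The kernel of a smooth matrix of locally constant
    rank is spanned by smooth sections ([smooth_kernel]), so every vector of
    F^p \cap W_k at a point is the value of a smooth local section; by
    conjugation and addition the same holds for Phi_p. As a complement of F^(p+1),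
    Phi_p has locally constant rank and hence local frames, and so does
    U^p = F^p \cap Phi_p ([frame_U]). The projections are smooth by Cramer's rule
    ([smooth_proj]).

    The differential calculus rests on directional derivatives. The chain rule,
    proved from the mean value theorem one real coordinate at a time, gives the
    linearity of the derivative in the direction and its independence of charts,
    so that nabla has values in 1-forms. *)

(** * Complex-valued functions of a real variable *)

Section Continuity.
Variables (K : numClosedFieldType) (T : topologicalType) (f g : T -> K) (x : T).
Hypotheses (cf : {for x, continuous f}) (cg : {for x, continuous g}).
Lemma continuousCD : {for x, continuous (fun y => f y + g y)}.
Proof. exact: (@cvgD K K T (nbhs x) _ f g). Qed.
Lemma continuousCM : {for x, continuous (fun y => f y * g y)}.
Proof. exact: (@cvgM K T (nbhs x) _ f g). Qed.
Lemma continuousCV : f x != 0 -> {for x, continuous (fun y => (f y)^-1)}.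
Proof. by move=> fx; exact: (@cvgV K T (nbhs x) _ f). Qed.
End Continuity.

Section CxTopology.
Variable R : realType.
Local Notation C := (Cx R).
Local Notation Re := (@complex.Re R).
Local Notation Im := (@complex.Im R).
Local Notation ofR t := (((t : R)%:C)%C : Cx R).
#[local] Instance Cx_nbhs_filter (z : C) : ProperFilter (nbhs z) := nbhs_pfilter z.

Lemma continuous_Re : continuous (fun z : C => Re z : R).
Proof.
move=> z; apply/cvgrPdist_lt => e e0.
have e0' : 0 < (e%:C)%C :> C by rewrite ltcR.
apply: filterS (nbhsx_ballx z _ e0').
move=> w; rewrite -ball_normE => /(le_lt_trans (normc_ge_Re _)).
by rewrite ltcR raddfB.
Qed.

Lemma continuous_real_complex : continuous (fun t : R => ofR t).
Proof.
move=> z; apply/cvgrPdist_lt => e; rewrite ltcE /= => /andP[/eqP e1 e0].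
have eE : e = ((Re e)%:C)%C by case: e e1 {e0} => a b /= ->.
rewrite eE; near=> w.
have -> : (z%:C)%C - (w%:C)%C = ((z - w)%:C)%C :> C by rewrite rmorphB.
have -> : `|((z - w)%:C)%C| = (`|z - w|%:C)%C :> C.
  by rewrite normc_def /= expr0n /= addr0 sqrtr_sqr.
rewrite ltcR; near: w.
have /cvgrPdist_lt : id w @[w --> z] --> z by exact: cvg_id.
exact.
Unshelve. all: by end_near. Qed.

Lemma conjC_complex (z : C) : z^* = (z^*)%C.
Proof. by []. Qed.
Lemma imag_complex : 'i = (0 +i* 1)%C :> C.
Proof. by rewrite -complexiE. Qed.
Lemma complex_split (z : C) : z = ofR (Re z) + 'i * ofR (Im z).
Proof. by rewrite imag_complex -complexE. Qed.
Lemma Im_Re (z : C) : Im z = Re (- 'i * z).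
Proof.
rewrite imag_complex; case: z => a b /=.
by rewrite oppr0 mul0r mulN1r sub0r opprK.
Qed.
Lemma continuous_Im : continuous (fun z : C => Im z : R).
Proof.
move=> z; rewrite (_ : (fun z : C => Im z) = (fun z => Re z) \o (fun z => - 'i * z)).
  by apply: continuous_comp; [exact: mulrl_continuous|exact: continuous_Re].
by apply/funext => w /=; rewrite Im_Re.
Qed.
Lemma continuous_conjC : continuous (fun z : C => z^*).
Proof.
move=> z.
rewrite (_ : (fun z : C => z^*) = fun z => ofR (Re z) - 'i * ofR (Im z)).
  apply: (@continuousCD C C (fun z => ofR (Re z)) (fun z => - ('i * ofR (Im z)))).
    exact: (continuous_comp (@continuous_Re z) (@continuous_real_complex _)).
  rewrite (_ : (fun z => _) = fun z => - 'i * ofR (Im z)); last first.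
    by apply/funext => w; rewrite mulNr.
  apply: (@continuousCM C C (fun=> - 'i) (fun z => ofR (Im z))).
    exact: cst_continuous.
  exact: (continuous_comp (@continuous_Im z) (@continuous_real_complex _)).
apply/funext => w; rewrite {1}(complex_split w) rmorphD rmorphM /=.
rewrite conjCi mulNr; congr (_ + - (_ * _)); exact: conjc_real.
Qed.

(** The derivative at 0 is enough: every directional derivative is the derivative
    at 0 of the restriction to a line. *)
Definition cder (h : R -> C) (l : C) : Prop :=
  is_derive (0 : R) (1 : R) (fun t => Re (h t) : R) (Re l : R) /\
  is_derive (0 : R) (1 : R) (fun t => Im (h t) : R) (Im l : R).

Lemma cder_near (h g : R -> C) l : (\forall t \near (0:R), h t = g t) ->
  cder h l -> cder g l.
Proof.
by move=> hg [h1 h2]; split; [apply: near_eq_is_derive h1|apply: near_eq_is_derive h2];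
  apply: filterS hg => t ->.
Qed.

Lemma cder_ext (h g : R -> C) l : h =1 g -> cder h l -> cder g l.
Proof. by move=> /funext ->. Qed.

Lemma cder_unique h l l' : cder h l -> cder h l' -> l = l'.
Proof.
move=> [[_ a] [_ b]] [[_ a'] [_ b']].
by rewrite (complex_split l) (complex_split l') -a -b -a' -b'.
Qed.

Lemma cder_cst (a : C) : cder (fun=> a) 0.
Proof. by split; exact: is_derive_cst. Qed.

Lemma Re_add (a b : C) : Re (a + b) = Re a + Re b.
Proof. by case: a b => [a a'] [b b']. Qed.
Lemma Im_add (a b : C) : Im (a + b) = Im a + Im b.
Proof. by case: a b => [a a'] [b b']. Qed.

Lemma ofRM (a b : R) : ofR (a * b) = ofR a * ofR b. Proof. exact: rmorphM. Qed.
Lemma ofRN (a : R) : ofR (- a) = - ofR a. Proof. exact: rmorphN. Qed.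
Lemma ofRV (a : R) : ofR (a^-1) = (ofR a)^-1. Proof. exact: fmorphV. Qed.

Lemma cderD h g a b : cder h a -> cder g b -> cder (fun t => h t + g t) (a + b).
Proof.
move=> [h1 h2] [g1 g2]; split.
  rewrite Re_add (_ : (fun t => _ (h t + g t)) =
    (fun t => Re (h t) : R) \+ (fun t => Re (g t) : R)).
    exact: is_deriveD.
  by apply/funext => t; rewrite Re_add.
rewrite Im_add (_ : (fun t => _ (h t + g t)) =
    (fun t => Im (h t) : R) \+ (fun t => Im (g t) : R)).
  exact: is_deriveD.
by apply/funext => t; rewrite Im_add.
Qed.

Lemma Re_mul (a b : C) : Re (a * b) = Re a * Re b - Im a * Im b.
Proof. by case: a b => [a a'] [b b']. Qed.
Lemma Im_mul (a b : C) : Im (a * b) = Re a * Im b + Im a * Re b.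
Proof. by case: a b => [a a'] [b b']. Qed.

Lemma cderM h g a b : cder h a -> cder g b ->
  cder (fun t => h t * g t) (a * g 0 + h 0 * b).
Proof.
move=> [h1 h2] [g1 g2]; split.
  rewrite (_ : (fun t => _ (h t * g t)) =
    ((fun t => Re (h t) : R) \* (fun t => Re (g t) : R)) \-
    ((fun t => Im (h t) : R) \* (fun t => Im (g t) : R))); last first.
    by apply/funext => t; rewrite Re_mul.
  apply: is_derive_eq (is_deriveB (is_deriveM h1 g1) (is_deriveM h2 g2)) _.
  by rewrite Re_add !Re_mul; rewrite /GRing.scale /=; ring.
rewrite (_ : (fun t => _ (h t * g t)) =
    ((fun t => Re (h t) : R) \* (fun t => Im (g t) : R)) \+
    ((fun t => Im (h t) : R) \* (fun t => Re (g t) : R))); last first.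
  by apply/funext => t; rewrite Im_mul.
apply: is_derive_eq (is_deriveD (is_deriveM h1 g2) (is_deriveM h2 g1)) _.
by rewrite Im_add !Im_mul; rewrite /GRing.scale /=; ring.
Qed.

Lemma Re_conj (z : C) : Re (z^*) = Re z. Proof. by case: z. Qed.
Lemma Im_conj (z : C) : Im (z^*) = - Im z. Proof. by case: z. Qed.

Lemma cder_conj h a : cder h a -> cder (fun t => (h t)^*) (a^*).
Proof.
move=> [h1 h2]; split.
  by rewrite Re_conj; under eq_fun do rewrite Re_conj.
rewrite Im_conj; under eq_fun do rewrite Im_conj.
exact: is_deriveN.
Qed.

Lemma cder_real (r : R -> R) (r' : R) : is_derive (0 : R) (1 : R) r r' ->
  cder (fun t => ofR (r t)) (ofR r').
Proof. by split => //=; exact: is_derive_cst. Qed.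

Lemma cder_linear (a : C) : cder (fun t => ofR t * a) a.
Proof.
have := cderM (cder_real (is_derive_id (0 : R) (1 : R))) (cder_cst a).
by rewrite mul1r mulr0 addr0.
Qed.

(** Since h^-1 is the product of the conjugate of h with the inverse of the real
    function |h|^2, the rule for real inverses suffices. *)
Lemma cderV h a : h 0 != 0 -> cder h a ->
  cder (fun t => (h t)^-1) (- a * (h 0)^-1 * (h 0)^-1).
Proof.
move=> h0 ha; have [h1 h2] := ha.
pose N t : R := Re (h t) * Re (h t) + Im (h t) * Im (h t).
have NE t : ofR (N t) = h t * (h t)^* :> C.
  rewrite conjC_complex /N; case: (h t) => x y /=.
  by apply/eqP; rewrite eq_complex /=; apply/andP; split; apply/eqP; ring.
have hc0 : (h 0)^* != 0 by rewrite conjC_eq0.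
have N0 : N 0 != 0.
  by rewrite -(inj_eq (@complexI R)) [ofR (N 0)]NE mulf_neq0.
have dN := is_deriveV N0 (is_deriveD (is_deriveM h1 h1) (is_deriveM h2 h2)).
have := cderM (cder_conj ha) (cder_real dN).
set l := (X in cder _ X) => H.
have <- : l = - a * (h 0)^-1 * (h 0)^-1.
  have dE : ofR (Re (h 0) * Re a + Re (h 0) * Re a + (Im (h 0) * Im a + Im (h 0) * Im a))
     = h 0 * a^* + (h 0)^* * a :> C.
    rewrite !conjC_complex; case: (h 0) (a) => x y [x' y'] /=.
    by apply/eqP; rewrite eq_complex /=; apply/andP; split; apply/eqP; ring.
  rewrite /l; move: (N 0) (NE 0) N0 => N1 NE1 N10.
  have -> x : - N1 ^- 2 *: x = - (N1^-1 * N1^-1 * x).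
    by rewrite expr2 invfM /GRing.scale /= mulNr.
  set x := (X in - (_ * X)); have xE : ofR x = h 0 * a^* + (h 0)^* * a := dE.
  rewrite ofRN 2!ofRM xE !ofRV NE1.
  move: h0 hc0; clear; move: (h 0) (h 0)^* a a^* => u v z w u0 v0.
  by field; rewrite u0 v0.
apply: cder_ext H => t; rewrite ofRV NE.
have [->|ht] := eqVneq (h t) 0; first by rewrite invr0 conjC0 mul0r.
by rewrite invfM mulrCA mulfV ?mulr1 // conjC_eq0.
Qed.

Section RealDerivatives.
Variable n : nat.
Implicit Types (f g : 'rV[C]_n -> C) (x v : 'rV[C]_n).

Lemma has_rderiveP f x v : has_rderive f x v <-> cder (line_at f x v) (rderive v f x).
Proof.
split.
  case=> h1 h2; split; apply: DeriveDef.
  - exact: h1.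
  - by rewrite -derive1E.
  - exact: h2.
  - by rewrite -derive1E.
by case=> -[h1 _] [h2 _]; split; [exact: h1|exact: h2].
Qed.

Lemma cder_rderive f x v l : cder (line_at f x v) l ->
  has_rderive f x v /\ rderive v f x = l.
Proof.
move=> h; have hr : has_rderive f x v.
  by case: h => -[h1 _] [h2 _]; split; [exact: h1|exact: h2].
by split=> //; apply: cder_unique h; apply/has_rderiveP.
Qed.

Lemma line_at0 f x v : line_at f x v 0 = f x.
Proof. by rewrite /line_at scale0r addr0. Qed.

End RealDerivatives.
End CxTopology.

(** * The chain rule for directional derivatives *)

Section ContinuityRow.
Variables (K : numClosedFieldType) (n : nat) (T : topologicalType).
Lemma continuousDZ (P : T -> 'rV[K]_n) (k : T -> K) (v : 'rV[K]_n) x :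
  {for x, continuous P} -> {for x, continuous k} ->
  {for x, continuous (fun y => P y + k y *: v)}.
Proof.
move=> cP ck; rewrite /prop_for /continuous_at.
apply: cvgD; first exact: cP.
by apply: cvgZr_tmp; exact: ck.
Qed.
End ContinuityRow.

Section Chain.
Variable R : realType.
Local Notation C := (Cx R).
Local Notation Re := (@complex.Re R).
Local Notation Im := (@complex.Im R).
Local Notation ofR t := (((t : R)%:C)%C : Cx R).

Lemma is_derive0P (phi : R -> R) (l : R) :
  h^-1 * (phi h - phi 0) @[h --> (0:R)^'] --> l <->
  is_derive (0 : R) (1 : R) phi l.
Proof.
have E : (fun h => h^-1 * (phi h - phi 0)) =
         (fun h : R => h^-1 *: ((phi \o shift (0:R)) (h *: (1:R)) - phi 0)).
  by apply/funext => h; rewrite /= /GRing.scale /= mulr1 addr0.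
rewrite E; split => [H|[H <-]]; last exact: H.
apply: DeriveDef; first exact: (cvgP _ H).
exact: (cvg_lim _ H).
Qed.

Lemma is_derive_shift (g : R -> R) (tau l : R) :
  is_derive (0 : R) (1 : R) (fun t => g (tau + t)) l ->
  is_derive tau (1 : R) g l.
Proof.
have E : (fun h : R => h^-1 *:
    (((fun t => g (tau + t)) \o shift (0:R)) (h *: (1:R)) - g (tau + 0))) =
  (fun h : R => h^-1 *: ((g \o shift tau) (h *: (1:R)) - g tau)).
  by apply/funext => h; rewrite /= !addr0 [tau + _]addrC.
move=> [h1 h2]; apply: DeriveDef.
  by rewrite /derivable -E; exact: h1.
by rewrite -h2 /derive E.
Qed.

Variable n : nat.
Implicit Types (f : 'rV[C]_n -> C) (x v : 'rV[C]_n).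

Lemma line_at_shift f x v tau t :
  line_at f (x + ofR tau *: v) v t = line_at f x v (tau + t).
Proof. by rewrite /line_at -addrA -scalerDl -rmorphD. Qed.

(** The mean value theorem holds for the real and for the imaginary part
    separately, with different intermediate points; rho stands for either part. *)
Lemma mvt_line (rho : C -> R) f x v (h : R) :
  (forall y, has_rderive f y v -> is_derive (0 : R) (1 : R)
     (fun t => rho (line_at f y v t)) (rho (rderive v f y))) ->
  (forall tau : R, `|tau| <= `|h| -> has_rderive f (x + ofR tau *: v) v) ->
  exists2 theta : R, `|theta| <= `|h| &
    rho (f (x + ofR h *: v)) - rho (f x) =
    h * rho (rderive v f (x + ofR theta *: v)).
Proof.
move=> rhoP fP.
pose g (t : R) : R := rho (line_at f x v t).
pose dg (t : R) : R := rho (rderive v f (x + ofR t *: v)).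
have dgP (t : R) : `|t| <= `|h| -> is_derive t (1 : R) g (dg t).
  move=> th; have H := rhoP _ (fP _ th).
  have E : (fun s => rho (line_at f (x + ofR t *: v) v s)) = (fun s => g (t + s)).
    by apply/funext => s; rewrite /g line_at_shift.
  by rewrite E in H; exact: (is_derive_shift H).
have -> : rho (f (x + ofR h *: v)) - rho (f x) = g h - g 0.
  by rewrite /g line_at0.
have [h0|h0] := leP 0 h.
  have B (t : R) : t \in `[0, h] -> `|t| <= `|h|.
    by rewrite in_itv /= => /andP[t0 th]; rewrite !ger0_norm.
  have [||c ch ->] := @MVT_segment R g dg 0 h h0.
  - by move=> t /subset_itv_oo_cc /B /dgP.
  - by apply: derivable_within_continuous => t /B /dgP [].
  - by exists c; [exact: B|rewrite subr0 mulrC].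
have B (t : R) : t \in `[h, 0] -> `|t| <= `|h|.
  by rewrite in_itv /= => /andP[t0 th]; rewrite !ler0_norm ?lerN2 // ltW.
have [||c ch E] := @MVT_segment R g dg h 0 (ltW h0).
- by move=> t /subset_itv_oo_cc /B /dgP.
- by apply: derivable_within_continuous => t /B /dgP [].
- exists c; first exact: B.
  by rewrite -opprB E sub0r mulrN opprK mulrC.
Qed.

(** Serves to keep the intermediate point of the mean value theorem, which is not a
    continuous function of t, inside a given neighbourhood. *)
Lemma continuous_along (y v : 'rV[C]_n) (N : set 'rV[C]_n)
    (P : R -> 'rV[C]_n) (h : R -> R) :
  nbhs y N -> P 0 = y -> {for 0, continuous P} ->
  h 0 = 0 -> {for 0, continuous h} ->
  \forall t \near (0:R), forall tau : R, `|tau| <= `|h t| -> N (P t + ofR tau *: v).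
Proof.
move=> yN Py cP h0 ch.
have c2 : {for (y, 0:R), continuous (fun p : 'rV[C]_n * R => p.1 + ofR p.2 *: v)}.
  apply: continuousDZ; first exact: cvg_fst.
  exact: (continuous_comp cvg_snd (@continuous_real_complex R _)).
have : nbhs (y, 0:R) [set p : 'rV[C]_n * R | N (p.1 + ofR p.2 *: v)].
  by apply: c2; rewrite /= scale0r addr0.
case=> -[A B] /= [yA B0] AB.
have [d /= d0 dB] : exists2 d : R, 0 < d & forall tau : R, `|tau| < d -> B tau.
  move/nbhs_ballP: B0 => [d d0 H]; exists d => // tau td; apply: H.
  by rewrite -ball_normE /ball_ /= sub0r normrN.
near=> t => tau th; apply: (AB (P t, tau)); split => /=.
  near: t; apply: cP; rewrite Py; exact: yA.
apply: dB; apply: le_lt_trans th _; near: t.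
move/cvgrPdist_lt : ch => /(_ d d0); apply: filterS => t.
by rewrite h0 sub0r normrN.
Unshelve. all: by end_near. Qed.

(** Shared properties of the real and imaginary parts. *)
Definition real_component (rho : C -> R) :=
  continuous rho /\ forall f x v, has_rderive f x v ->
     is_derive (0 : R) (1 : R)
     (fun t => rho (line_at f x v t)) (rho (rderive v f x)).

(** Adding one more moving direction h(t) v to a curve P adds the term h'(0) D_v f to
    the derivative: the increment of f along v is h(t) times a value of D_v f at
    a point tending to y, by the mean value theorem and the continuity of D_v f. *)
Lemma chain_step_real rho f y v (P : R -> 'rV[C]_n) (h : R -> R) (w l : R) :
  real_component rho ->
  P 0 = y -> {for 0, continuous P} -> h 0 = 0 -> is_derive (0:R) (1:R) h w ->
  (\forall x \near y, has_rderive f x v) -> {for y, continuous (rderive v f)} ->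
  is_derive (0:R) (1:R) (fun t => rho (f (P t))) l ->
  is_derive (0:R) (1:R) (fun t => rho (f (P t + ofR (h t) *: v)))
    (l + w * rho (rderive v f y)).
Proof.
move=> [rhoc rhoP] Py cP h0 dh fy cy dl.
set D := rho (rderive v f y).
pose phi t : R := rho (f (P t + ofR (h t) *: v)) - rho (f (P t)).
have phi0 : phi 0 = 0 by rewrite /phi h0 scale0r addr0 subrr.
have ch : {for 0, continuous h}.
  apply: differentiable_continuous; apply/derivable1_diffP; by case: dh.
suff dphi : is_derive (0:R) (1:R) phi (w * D).
  have := is_deriveD dl dphi.
  rewrite (_ : _ + phi = fun t => rho (f (P t + ofR (h t) *: v)))%R; first by [].
  by apply/funext => t; rewrite /phi /GRing.add /= addrC subrK.
apply/is_derive0P; rewrite phi0.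
(* The difference quotient along v, completed by its limit where h vanishes. *)
pose E (t : R) : R := if h t == 0 then D else phi t / h t.
have phiE t : phi t = h t * E t.
  rewrite /E; case: eqVneq => [ht|ht]; last by rewrite mulrC divfK.
  by rewrite /phi ht scale0r addr0 subrr mul0r.
rewrite (_ : (fun t => _) = fun t => (t^-1 * (h t - h 0)) * E t); last first.
  by apply/funext => t; rewrite h0 !subr0 phiE mulrA.
apply: cvgM; first by apply/is_derive0P.
apply/cvgrPdist_lt => e e0; apply: nbhs_dnbhs.
have cD : {for y, continuous (fun z => rho (rderive v f z))}.
  exact: (continuous_comp cy (rhoc _)).
have N : \forall z \near y, has_rderive f z v /\ `|D - rho (rderive v f z)| < e.
  by near=> z; split; near: z => //; move/cvgrPdist_lt : cD => /(_ e e0).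
have := continuous_along v N Py cP h0 ch.
apply: filterS => t Nt; rewrite /E; case: eqVneq => [_|ht]; first by rewrite subrr normr0.
have hr (tau : R) (th : `|tau| <= `|h t|) : has_rderive f (P t + ofR tau *: v) v.
  by case: (Nt tau th).
have [theta th E'] := mvt_line (fun z => rhoP f z v) hr.
by rewrite /phi E' mulrAC mulfV // mul1r; case: (Nt _ th).
Unshelve. all: by end_near. Qed.

Lemma real_component_Re : real_component Re.
Proof. by split; [exact: continuous_Re|move=> f x v /has_rderiveP []]. Qed.
Lemma real_component_Im : real_component Im.
Proof. by split; [exact: continuous_Im|move=> f x v /has_rderiveP []]. Qed.

Definition C1_at f y := forall v,
  (\forall x \near y, has_rderive f x v) /\ {for y, continuous (rderive v f)}.

Lemma chain_step f y v (P : R -> 'rV[C]_n) (h : R -> R) (w : R) (l : C) :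
  C1_at f y -> P 0 = y -> {for 0, continuous P} -> h 0 = 0 ->
  is_derive (0:R) (1:R) h w -> cder (fun t => f (P t)) l ->
  cder (fun t => f (P t + ofR (h t) *: v)) (l + ofR w * rderive v f y).
Proof.
move=> /(_ v) [fy cy] Py cP h0 dh [d1 d2].
have := chain_step_real real_component_Re Py cP h0 dh fy cy d1.
have := chain_step_real real_component_Im Py cP h0 dh fy cy d2.
move=> H2 H1; split; first by rewrite Re_add Re_mul /= mul0r subr0; exact: H1.
by rewrite Im_add Im_mul /= mul0r addr0; exact: H2.
Qed.

Lemma chain_seq (J : Type) (r : seq J) (h : J -> R -> R) (w : J -> R)
    (b : J -> 'rV[C]_n) f y :
  C1_at f y -> (forall j, h j 0 = 0) ->
  (forall j, is_derive (0:R) (1:R) (h j) (w j)) ->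
  cder (fun t => f (y + \sum_(j <- r) ofR (h j t) *: b j))
       (\sum_(j <- r) ofR (w j) * rderive (b j) f y).
Proof.
move=> fy h0 dh.
pose c (s : seq J) (t : R) := y + \sum_(j <- s) ofR (h j t) *: b j.
suff [_ _] : [/\ c r 0 = y, {for 0, continuous (c r)} &
  cder (fun t => f (c r t)) (\sum_(j <- r) ofR (w j) * rderive (b j) f y)] by [].
elim: r => [|j r [IH1 IH2 IH3]].
  have E : c [::] = fun=> y by apply/funext => t; rewrite /c big_nil addr0.
  rewrite E big_nil; split => //; [exact: cst_continuous|exact: cder_cst].
have E : c (j :: r) = fun t => c r t + ofR (h j t) *: b j.
  by apply/funext => t; rewrite /c big_cons addrA addrAC.
rewrite E; split; first by rewrite IH1 h0 scale0r addr0.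
  apply: continuousDZ => //.
  apply: (@continuous_comp _ _ _ (h j) (fun t => ofR t)).
    by apply: differentiable_continuous; apply/derivable1_diffP; case: (dh j).
  exact: continuous_real_complex.
by rewrite big_cons addrC; exact: (chain_step (b j) fy IH1 IH2 (h0 j) (dh j) IH3).
Qed.

(** The real basis of C^n formed by the e_j (for false) and the i e_j (for true). *)
Definition rbasis (p : 'I_n * bool) : 'rV[C]_n :=
  (if p.2 then 'i else 1) *: delta_mx 0 p.1.
Definition rcoord (w : 'rV[C]_n) (p : 'I_n * bool) : R :=
  if p.2 then Im (w 0 p.1) else Re (w 0 p.1).

Lemma sum_rcoord (w : 'rV[C]_n) : w = \sum_p ofR (rcoord w p) *: rbasis p.
Proof.
rewrite -(pair_bigA _ (fun j c => ofR (rcoord w (j, c)) *: rbasis (j, c))) /=.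
rewrite [LHS]row_sum_delta; apply: eq_bigr => j _.
rewrite big_bool /rcoord /rbasis /= !scalerA -scalerDl mulr1.
by rewrite {1}(complex_split (w 0 j)) addrC mulrC.
Qed.

(** The real-linear differential of f at y, from the partial derivatives. *)
Definition rdiff f y w : C := \sum_p ofR (rcoord w p) * rderive (rbasis p) f y.

Lemma chain_rdiff f (g : R -> 'rV[C]_n) (w : 'rV[C]_n) :
  C1_at f (g 0) -> (forall j, cder (fun t => g t 0 j) (w 0 j)) ->
  cder (fun t => f (g t)) (rdiff f (g 0) w).
Proof.
move=> fy dg; pose h p (t : R) : R := rcoord (g t - g 0) p.
have h0 p : h p 0 = 0 by rewrite /h /rcoord subrr mxE; case: p.2.
have dh p : is_derive (0:R) (1:R) (h p) (rcoord w p).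
  have := cderD (dg p.1) (cder_cst (- g 0 0 p.1)); rewrite addr0.
  case=> d1 d2; rewrite /h /rcoord; case: p.2.
    by under eq_fun do rewrite !mxE.
  by under eq_fun do rewrite !mxE.
apply: cder_ext (chain_seq (index_enum _) rbasis fy h0 dh) => t.
by rewrite -sum_rcoord addrC subrK.
Qed.

Lemma cder_line (y w : 'rV[C]_n) j : cder (fun t => (y + ofR t *: w) 0 j) (w 0 j).
Proof.
have := cderD (cder_cst (y 0 j)) (cder_linear (w 0 j)); rewrite add0r.
by under [in X in _ -> X]eq_fun do rewrite !mxE.
Qed.

(** A directional derivative is the derivative along a line, so the chain rule for
    curves expresses it through the partial derivatives; this makes it
    real-linear in the direction. *)
Lemma rderive_rdiff f y w : C1_at f y -> rderive w f y = rdiff f y w.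
Proof.
move=> fy; have [] // := @cder_rderive _ _ f y w (rdiff f y w) _.
have := @chain_rdiff f (fun t => y + ofR t *: w) w.
by rewrite scale0r addr0; apply=> // j; exact: cder_line.
Qed.

Lemma chain_rule f (g : R -> 'rV[C]_n) (w : 'rV[C]_n) :
  C1_at f (g 0) -> (forall j, cder (fun t => g t 0 j) (w 0 j)) ->
  cder (fun t => f (g t)) (rderive w f (g 0)).
Proof. by move=> fy dg; rewrite rderive_rdiff //; exact: chain_rdiff. Qed.

Lemma rderiveDv f y v w : C1_at f y ->
  rderive (v + w) f y = rderive v f y + rderive w f y.
Proof.
move=> fy; rewrite !rderive_rdiff // -big_split /=; apply: eq_bigr => p _.
rewrite -mulrDl -rmorphD; congr (ofR _ * _).
by rewrite /rcoord mxE; case: p.2; rewrite ?Re_add ?Im_add.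
Qed.

Lemma rderiveZv f y (a : R) v : C1_at f y ->
  rderive (ofR a *: v) f y = ofR a * rderive v f y.
Proof.
move=> fy; rewrite !rderive_rdiff // mulr_sumr /=; apply: eq_bigr => p _.
rewrite mulrA -ofRM; congr (ofR _ * _).
by rewrite /rcoord mxE; case: p.2; rewrite ?Re_mul ?Im_mul /= ?mul0r ?subr0 ?addr0.
Qed.
End Chain.

(** * Functions of class C^k *)

Section Smooth.
Variable R : realType.
Local Notation C := (Cx R).
Local Notation Re := (@complex.Re R).
Local Notation Im := (@complex.Im R).
Local Notation ofR t := (((t : R)%:C)%C : Cx R).

Lemma near_eq_continuous (T U : topologicalType) (f g : T -> U) x :
  (\forall y \near x, f y = g y) -> {for x, continuous f} -> {for x, continuous g}.
Proof.
move=> fg cf; rewrite /prop_for /continuous_at -(nbhs_singleton fg).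
by apply: cvg_trans cf; apply: near_eq_cvg; apply: filterS fg => y ->.
Qed.

Section Functions.
Variable n : nat.
Implicit Types (f g : 'rV[C]_n -> C) (U : set 'rV[C]_n) (x v : 'rV[C]_n).

Lemma near_line U x v : nbhs x U -> \forall t \near (0:R), U (x + ofR t *: v).
Proof.
move=> xU.
have c : {for (0:R), continuous (fun t : R => x + ofR t *: v)}.
  apply: continuousDZ; [exact: cst_continuous|exact: continuous_real_complex].
by apply: c; rewrite scale0r addr0.
Qed.

Lemma cder_line_near f g x v l : (\forall y \near x, f y = g y) ->
  cder (line_at f x v) l -> cder (line_at g x v) l.
Proof. by move=> /(@near_line _ _ v) fg; exact: cder_near. Qed.

Lemma Ck_on_sub k U V f : U `<=` V -> Ck_on k V f -> Ck_on k U f.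
Proof.
elim: k f => [|k IH] f UV [cf df]; split; try by move=> x /UV /cf.
  by [].
move=> v; have [h1 h2] := df v; split; last exact: IH.
by move=> x /UV /h1.
Qed.

Lemma Ck_onW k U f : Ck_on k.+1 U f -> Ck_on k U f.
Proof.
elim: k f => [|k IH] f [cf df]; split => //.
move=> v; have [h1 h2] := df v; split; [exact: h1|exact: IH].
Qed.

Lemma Ck_on_eq k U f g : open U -> (forall x, U x -> f x = g x) ->
  Ck_on k U f -> Ck_on k U g.
Proof.
move=> oU; elim: k f g => [|k IH] f g fg [cf df]; split.
- move=> x Ux; apply: near_eq_continuous (cf x Ux).
  by near=> y; apply: fg; near: y; exact: open_nbhs_nbhs.
- by [].
- move=> x Ux; apply: near_eq_continuous (cf x Ux).
  by near=> y; apply: fg; near: y; exact: open_nbhs_nbhs.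
- move=> v; have [h1 h2] := df v.
  have H x : U x -> cder (line_at g x v) (rderive v f x).
    move=> Ux; apply: (@cder_line_near f); last by apply/has_rderiveP; exact: h1.
    by near=> y; apply: fg; near: y; exact: open_nbhs_nbhs.
  split; first by move=> x /H /cder_rderive [].
  by apply: IH h2 => x /H /cder_rderive [_ ->].
Unshelve. all: by end_near. Qed.

(** It is enough to exhibit some functions that are the derivatives of f on U. *)
Lemma Ck_onS k U f : open U -> (forall x, U x -> {for x, continuous f}) ->
  (forall v, exists2 g, (forall x, U x -> cder (line_at f x v) (g x)) & Ck_on k U g) ->
  Ck_on k.+1 U f.
Proof.
move=> oU cf df; split => // v; have [g h1 h2] := df v.
split; first by move=> x /h1 /cder_rderive [].
by apply: Ck_on_eq h2 => // x /h1 /cder_rderive [_ ->].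
Qed.

Lemma Ck_on_cder k U f x v : Ck_on k.+1 U f -> U x ->
  cder (line_at f x v) (rderive v f x).
Proof. by move=> [_ /(_ v) [h _]] Ux; apply/has_rderiveP; exact: h. Qed.

Lemma Ck_on_rderive k U f v : Ck_on k.+1 U f -> Ck_on k U (rderive v f).
Proof. by move=> [_ /(_ v) []]. Qed.

Lemma Ck_on_C1 k U f x : open U -> Ck_on k.+1 U f -> U x -> C1_at f x.
Proof.
move=> oU [_ df] Ux v; have [h1 h2] := df v; split; last first.
  by case: (k) h2 => [|?] [h _]; exact: h.
by near=> y; apply: h1; near: y; exact: open_nbhs_nbhs.
Unshelve. all: by end_near. Qed.

Lemma Ck_on_cst k U (a : C) : open U -> Ck_on k U (fun=> a).
Proof.
move=> oU; elim: k a => [|k IH] a.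
  by split; [move=> x _; exact: cst_continuous|exact: Logic.I].
apply: (Ck_onS oU); first by move=> x _; exact: cst_continuous.
by move=> v; exists (fun=> 0) => // x _; exact: cder_cst.
Qed.

Lemma Ck_onD k U f g : open U -> Ck_on k U f -> Ck_on k U g ->
  Ck_on k U (fun x => f x + g x).
Proof.
move=> oU; elim: k f g => [|k IH] f g hf hg.
  by case: hf hg => [cf _] [cg _]; split; [move=> x Ux|exact: Logic.I];
    exact: (continuousCD (cf x Ux) (cg x Ux)).
have [cf _] := hf; have [cg _] := hg.
apply: (Ck_onS oU); first by move=> x Ux; exact: (continuousCD (cf x Ux) (cg x Ux)).
move=> v; exists (fun x => rderive v f x + rderive v g x).
  by move=> x Ux; apply: (cderD (Ck_on_cder v hf Ux) (Ck_on_cder v hg Ux)).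
by apply: IH; exact: Ck_on_rderive.
Qed.

Lemma Ck_onM k U f g : open U -> Ck_on k U f -> Ck_on k U g ->
  Ck_on k U (fun x => f x * g x).
Proof.
move=> oU; elim: k f g => [|k IH] f g hf hg.
  by case: hf hg => [cf _] [cg _]; split; [move=> x Ux|exact: Logic.I];
    exact: (continuousCM (cf x Ux) (cg x Ux)).
have [cf _] := hf; have [cg _] := hg.
apply: (Ck_onS oU); first by move=> x Ux; exact: (continuousCM (cf x Ux) (cg x Ux)).
move=> v; exists (fun x => rderive v f x * g x + f x * rderive v g x).
  move=> x Ux; have := cderM (Ck_on_cder v hf Ux) (Ck_on_cder v hg Ux).
  by rewrite !line_at0; exact.
apply: Ck_onD => //; apply: IH; by [exact: Ck_on_rderive|exact: Ck_onW].
Qed.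

Lemma Ck_on_conj k U f : open U -> Ck_on k U f -> Ck_on k U (fun x => (f x)^*).
Proof.
move=> oU; elim: k f => [|k IH] f hf.
  by case: hf => [cf _]; split; [move=> x Ux|exact: Logic.I];
    exact: (continuous_comp (cf x Ux) (@continuous_conjC R _)).
have [cf _] := hf.
apply: (Ck_onS oU).
  by move=> x Ux; exact: (continuous_comp (cf x Ux) (@continuous_conjC R _)).
move=> v; exists (fun x => (rderive v f x)^*).
  by move=> x Ux; exact: cder_conj (Ck_on_cder v hf Ux).
by apply: IH; exact: Ck_on_rderive.
Qed.

Lemma Ck_onV k U f : open U -> (forall x, U x -> f x != 0) -> Ck_on k U f ->
  Ck_on k U (fun x => (f x)^-1).
Proof.
move=> oU f0; elim: k => [|k IH] hf.
  by case: hf => [cf _]; split; [move=> x Ux|exact: Logic.I];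
    exact: (continuousCV (cf x Ux) (f0 x Ux)).
have [cf _] := hf.
apply: (Ck_onS oU).
  by move=> x Ux; exact: (continuousCV (cf x Ux) (f0 x Ux)).
move=> v; exists (fun x => -1 * rderive v f x * (f x)^-1 * (f x)^-1).
  move=> x Ux; rewrite mulN1r.
  have := @cderV _ (line_at f x v) _ _ (Ck_on_cder v hf Ux).
  by rewrite !line_at0; apply; exact: f0.
have hV := IH (Ck_onW hf).
do 3!apply: Ck_onM => //; [exact: Ck_on_cst|exact: Ck_on_rderive].
Qed.

Lemma Ck_on_sum k U (J : Type) (r : seq J) (f : J -> 'rV[C]_n -> C) : open U ->
  (forall j, Ck_on k U (f j)) -> Ck_on k U (fun x => \sum_(j <- r) f j x).
Proof.
move=> oU hf; elim: r => [|j r IH].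
  by under eq_fun do rewrite big_nil; exact: Ck_on_cst.
by under eq_fun do rewrite big_cons; exact: Ck_onD.
Qed.

Lemma Ck_on_real k U f : open U -> Ck_on k U f -> Ck_on k U (fun x => ofR (Re (f x))).
Proof.
move=> oU hf; have -> : (fun x => ofR (Re (f x))) = (fun x => (f x + (f x)^*) * 2^-1).
  by apply/funext => x; exact: ReJ_add.
apply: (Ck_onM oU); last exact: Ck_on_cst.
by apply: (Ck_onD oU) => //; exact: Ck_on_conj.
Qed.

Lemma Ck_on_imag k U f : open U -> Ck_on k U f -> Ck_on k U (fun x => ofR (Im (f x))).
Proof.
move=> oU hf; have -> : (fun x => ofR (Im (f x))) = (fun x => ofR (Re (- 'i * f x))).
  by apply/funext => x; rewrite Im_Re.
apply: (Ck_on_real oU); apply: (Ck_onM oU) => //; exact: Ck_on_cst.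
Qed.

End Functions.

(** By the chain rule the derivatives of f o phi are polynomials in the derivatives
    of phi and in the D_b f o phi, which are of class C^k by induction. *)
Lemma Ck_on_comp n m k (U : set 'rV[C]_n) (V : set 'rV[C]_m) (f : 'rV[C]_m -> C)
    (phi : 'rV[C]_n -> 'rV[C]_m) :
  open U -> open V -> (forall x, U x -> V (phi x)) ->
  (forall x, U x -> {for x, continuous phi}) ->
  (forall j, Ck_on k U (fun x => phi x 0 j)) -> Ck_on k V f ->
  Ck_on k U (fun x => f (phi x)).
Proof.
move=> oU oV UV cphi; elim: k f => [|k IH] f hphi hf.
  by case: hf => [cf _]; split; [move=> x Ux|exact: Logic.I];
    exact: (continuous_comp (cphi x Ux) (cf _ (UV x Ux))).
have [cf _] := hf.
apply: (Ck_onS oU).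
  by move=> x Ux; exact: (continuous_comp (cphi x Ux) (cf _ (UV x Ux))).
move=> v; exists (fun x => rdiff f (phi x) (\row_j rderive v (fun x => phi x 0 j) x)).
  move=> x Ux.
  have H := @chain_rdiff R m f (fun t => phi (x + ofR t *: v))
    (\row_j rderive v (fun x => phi x 0 j) x).
  rewrite scale0r addr0 in H; apply: H.
    exact: (Ck_on_C1 oV hf (UV x Ux)).
  by move=> j; rewrite mxE; exact: (Ck_on_cder v (hphi j) Ux).
apply: (Ck_on_sum _ oU) => -[j b]; apply: (Ck_onM oU).
  rewrite /rcoord /=; case: b.
    under eq_fun do rewrite mxE.
    by apply: (Ck_on_imag oU); exact: Ck_on_rderive.
  under eq_fun do rewrite mxE.
  by apply: (Ck_on_real oU); exact: Ck_on_rderive.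
apply: IH; last exact: Ck_on_rderive.
by move=> i; exact: Ck_onW.
Qed.
End Smooth.

(** * Smooth functions on the manifold *)

Lemma nbhs_neq0 (K : numClosedFieldType) (a : K) : a != 0 ->
  nbhs a [set z | z != 0].
Proof.
rewrite -normr_gt0 => a0; apply: (filterS _ (nbhsx_ballx a _ a0)) => z.
rewrite -ball_normE /= => az; apply/eqP => z0.
by move: az; rewrite z0 subr0 ltxx.
Qed.

Section Germs.
Variables (R : realType) (S : topologicalType) (M : complex_manifold R S).
Local Notation C := (Cx R).
Local Notation ofR t := (((t : R)%:C)%C : Cx R).
Implicit Types (f g : S -> C) (s : S) (O : set S) (c : chart M).

(** The definition of the class C^k is a conjunction of conditions at single
    points. *)
Lemma Ck_on_local n k (U : set 'rV[C]_n) (f : 'rV[C]_n -> C) :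
  (forall x, U x -> exists2 W : set 'rV[C]_n, W x & Ck_on k W f) -> Ck_on k U f.
Proof.
elim: k f => [|k IH] f H; split.
- by move=> x /H [W Wx [cf _]]; exact: cf.
- exact: Logic.I.
- by move=> x /H [W Wx [cf _]]; exact: cf.
- move=> v; split; first by move=> x /H [W Wx [_ /(_ v) [h _]]]; exact: h.
  by apply: IH => x /H [W Wx [_ /(_ v) [_ h]]]; exists W.
Qed.

Lemma near_coordV c s (N : set S) : cdom c s -> nbhs s N ->
  \forall x \near Defs.coord c s, N (@coordV _ _ M c x).
Proof.
move=> cs sN.
have := @coordV_continuous _ _ M c (Defs.coord c s) (imageP _ cs).
by rewrite /prop_for /continuous_at coordK //; apply.
Qed.

Lemma near_coord c s (N : set 'rV[C]_(cdim c)) : cdom c s -> nbhs (Defs.coord c s) N ->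
  \forall t \near s, N (Defs.coord c t).
Proof. by move=> cs; exact: (Defs.coord_continuous cs). Qed.

Lemma nbhs_cdom c s : cdom c s -> nbhs s (cdom c).
Proof. by move=> cs; apply: open_nbhs_nbhs; split => //; exact: cdom_open. Qed.

Lemma open_coord_image c O : open O -> open (Defs.coord c @` (O `&` cdom c)).
Proof.
move=> oO; rewrite openE => _ [s [Os cs] <-].
have : \forall x \near Defs.coord c s, O (@coordV _ _ M c x).
  by apply: near_coordV => //; exact: open_nbhs_nbhs.
have : \forall x \near Defs.coord c s, (Defs.coord c @` cdom c) x.
  by apply: open_nbhs_nbhs; split; [exact: cimg_open|exact: imageP].
apply: filterS2 => _ [t ct <-] ; rewrite Defs.coordK // => Ot; exact: imageP.
Qed.

(** Smoothness is required in all charts, as in the definition of smooth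
    sections; [smooth_at_chart] reduces it to one chart. *)
Definition smooth_fun O f := forall c,
  smooth_on (Defs.coord c @` (O `&` cdom c)) (fun x => f (coordV x)).

(** A condition on the germ of f at s: f is smooth on some neighbourhood. *)
Definition smooth_at s f := exists2 O, open_nbhs s O & smooth_fun O f.

Lemma smooth_fun_sub O P f : O `<=` P -> smooth_fun P f -> smooth_fun O f.
Proof.
move=> OP h c k; apply: Ck_on_sub (h c k) => _ [s [Os cs] <-].
by apply: imageP; split=> //; exact: OP.
Qed.

Lemma smooth_fun_at O f s : open O -> O s -> smooth_fun O f -> smooth_at s f.
Proof. by move=> oO Os; exists O. Qed.

Lemma smooth_at_near s f : smooth_at s f -> \forall t \near s, smooth_at t f.
Proof.
move=> [ O [oO Os] h]; have : nbhs s O by exact: open_nbhs_nbhs.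
by apply: filterS => t Ot; exact: smooth_fun_at h.
Qed.

Lemma smooth_fun_local O f : (forall s, O s -> smooth_at s f) -> smooth_fun O f.
Proof.
move=> h c k; apply: Ck_on_local => _ [s [Os cs] <-].
have [P [oP Ps] hP] := h s Os.
by exists (Defs.coord c @` (P `&` cdom c)); [exact: imageP|exact: hP].
Qed.

Lemma smooth_at_eq s f g : (\forall t \near s, f t = g t) -> smooth_at s f -> smooth_at s g.
Proof.
move=> fg [ O [oO Os] h]; have /nbhs_interior fgi := fg.
exists (O `&` interior [set t | f t = g t]).
  by split; [apply: openI => //; exact: open_interior|split => //; exact: nbhs_singleton].
move=> c k; apply: (@Ck_on_eq _ _ _ _ (fun x => f (coordV x))).
- by apply: open_coord_image; apply: openI => //; exact: open_interior.
- by move=> _ [t [[_ /interior_subset E] ct] <-]; rewrite Defs.coordK.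
- apply: Ck_on_sub (h c k) => _ [t [[Ot _] ct] <-]; exact: imageP.
Qed.

Lemma smooth_at_cst s (a : C) : smooth_at s (fun=> a).
Proof.
exists setT; first by split => //; exact: openT.
by move=> c k; apply: Ck_on_cst; apply: open_coord_image; exact: openT.
Qed.

Lemma smooth_atI s f g : smooth_at s f -> smooth_at s g ->
  exists O, [/\ open O, O s, smooth_fun O f & smooth_fun O g].
Proof.
move=> [ O [oO Os] hf] [P [oP Ps] hg]; exists (O `&` P); split => //.
- exact: openI.
- by apply: smooth_fun_sub hf => t [].
- by apply: smooth_fun_sub hg => t [].
Qed.

Lemma smooth_atD s f g : smooth_at s f -> smooth_at s g ->
  smooth_at s (fun t => f t + g t).
Proof.
move=> hf hg; have [ O [oO Os {}hf {}hg]] := smooth_atI hf hg.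
exists O; first (by split); move=> c k.
exact: (Ck_onD (open_coord_image oO) (hf c k) (hg c k)).
Qed.

Lemma smooth_atM s f g : smooth_at s f -> smooth_at s g ->
  smooth_at s (fun t => f t * g t).
Proof.
move=> hf hg; have [ O [oO Os {}hf {}hg]] := smooth_atI hf hg.
exists O; first (by split); move=> c k.
exact: (Ck_onM (open_coord_image oO) (hf c k) (hg c k)).
Qed.

Lemma smooth_at_conj s f : smooth_at s f -> smooth_at s (fun t => (f t)^*).
Proof.
move=> [ O [oO Os] hf].
exists O; first (by split); move=> c k.
exact: (Ck_on_conj (open_coord_image oO) (hf c k)).
Qed.

Lemma smooth_at_continuous s f : smooth_at s f -> {for s, continuous f}.
Proof.
move=> [ O [oO Os] hf]; have [c cs] := cdom_cover M s.
have [cf _] := hf c 0%N.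
have {}cf := cf (Defs.coord c s) (imageP _ (conj Os cs)).
apply: (@near_eq_continuous _ _ (fun t => f (coordV (Defs.coord c t)))).
  by apply: filterS (nbhs_cdom cs) => t ct; rewrite Defs.coordK.
apply: (@continuous_comp _ _ _ (Defs.coord c) (fun x => f (coordV x))) => //.
exact: Defs.coord_continuous.
Qed.

Lemma smooth_at_neq0 s f : smooth_at s f -> f s != 0 -> \forall t \near s, f t != 0.
Proof.
move=> /smooth_at_continuous cf f0.
apply: (cf [set z | z != 0]); exact: nbhs_neq0.
Qed.

Lemma smooth_atV s f : smooth_at s f -> f s != 0 -> smooth_at s (fun t => (f t)^-1).
Proof.
move=> hf f0; have /nbhs_interior N := smooth_at_neq0 hf f0.
move: hf => [ O [oO Os] hf].
pose P := O `&` interior [set t | f t != 0].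
have oP : open P by apply: openI => //; exact: open_interior.
exists P; first by split => //; split => //; exact: nbhs_singleton.
move=> c k; apply: (Ck_onV (open_coord_image oP)).
  by move=> _ [t [[_ /interior_subset E] ct] <-]; rewrite Defs.coordK.
by apply: Ck_on_sub (hf c k) => _ [t [[Ot _] ct] <-]; exact: imageP.
Qed.

Lemma smooth_at_sum s (J : Type) (r : seq J) (P : pred J) (f : J -> S -> C) :
  (forall j, smooth_at s (f j)) -> smooth_at s (fun t => \sum_(j <- r | P j) f j t).
Proof.
move=> hf; elim: r => [|j r IH].
  by under eq_fun do rewrite big_nil; exact: smooth_at_cst.
under eq_fun do rewrite big_cons; case: (P j) => //; exact: smooth_atD.
Qed.

Lemma smooth_at_prod s (J : Type) (r : seq J) (P : pred J) (f : J -> S -> C) :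
  (forall j, smooth_at s (f j)) -> smooth_at s (fun t => \prod_(j <- r | P j) f j t).
Proof.
move=> hf; elim: r => [|j r IH].
  by under eq_fun do rewrite big_nil; exact: smooth_at_cst.
under eq_fun do rewrite big_cons; case: (P j) => //; exact: smooth_atM.
Qed.

(** One chart suffices, as the transition maps are holomorphic. *)
Lemma smooth_at_chart c s (W : set 'rV[C]_(cdim c)) f :
  cdom c s -> open W -> W (Defs.coord c s) -> smooth_on W (fun x => f (coordV x)) ->
  smooth_at s f.
Proof.
move=> cs oW Ws hW.
pose O := cdom c `&` interior [set t | W (Defs.coord c t)].
have oO : open O by apply: openI; [exact: cdom_open|exact: open_interior].
exists O.
  split => //; split => //; apply: nbhs_singleton; apply: nbhs_interior.
  by apply: near_coord => //; exact: open_nbhs_nbhs.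
move=> c' k.
have oI := @open_coord_image c' _ oO.
apply: (@Ck_on_eq _ _ _ _ (fun x => f (coordV (Defs.coord c (@coordV _ _ M c' x))))) => //.
  by move=> _ [t [[ct _] ct'] <-]; rewrite !coordK.
apply: (@Ck_on_comp _ _ _ _ _ W (fun x => f (coordV x))
  (fun x => Defs.coord c (@coordV _ _ M c' x))) => //.
- by move=> _ [t [[ct /interior_subset Wt] ct'] <-]; rewrite Defs.coordK.
- move=> _ [t [[ct _] ct'] <-].
  apply: (@continuous_comp _ _ _ (@coordV _ _ M c') (Defs.coord c)).
    by apply: coordV_continuous; exact: imageP.
  by rewrite Defs.coordK //; exact: Defs.coord_continuous.
- move=> j; have [h _] := @transition_holomorphic _ _ M c' c j.
  apply: Ck_on_sub (h k) => _ [t [[ct _] ct'] <-]; exact: imageP.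
Qed.

(** The derivative of f at s along the tangent vector with coordinates v in the
    chart c. *)
Definition dmf c (v : 'rV[C]_(cdim c)) f s : C :=
  rderive v (fun x => f (coordV x)) (Defs.coord c s).

Lemma smooth_at_dmf c v s f : cdom c s -> smooth_at s f -> smooth_at s (@dmf c v f).
Proof.
move=> cs [ O [oO Os] hf]; have oI := @open_coord_image c _ oO.
apply: (smooth_at_chart cs oI (imageP _ (conj Os cs))) => k.
apply: (@Ck_on_eq _ _ _ _ (rderive v (fun x => f (coordV x)))) => //.
  by move=> _ [t [Ot ct] <-]; rewrite /dmf coordK.
exact: (Ck_on_rderive v (hf c k.+1)).
Qed.

Lemma dmf_cderP c v s f : cdom c s -> smooth_at s f ->
  cder (line_at (fun x => f (coordV x)) (Defs.coord c s) v) (@dmf c v f s).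
Proof.
move=> cs [ O [oO Os] hf].
exact: (Ck_on_cder v (hf c 1%N) (imageP _ (conj Os cs))).
Qed.

Lemma dmf_unique c v s f l :
  cder (line_at (fun x => f (coordV x)) (Defs.coord c s) v) l -> @dmf c v f s = l.
Proof. by move=> /cder_rderive []. Qed.

Lemma dmf_eq c v s f g : cdom c s -> smooth_at s f -> (\forall t \near s, f t = g t) ->
  @dmf c v f s = dmf v g s.
Proof.
move=> cs hf fg; apply/esym/dmf_unique; apply: cder_line_near (dmf_cderP v cs hf).
exact: (near_coordV cs fg).
Qed.

Lemma dmf_cst c v s (a : C) : @dmf c v (fun=> a) s = 0.
Proof. by apply: dmf_unique; exact: cder_cst. Qed.

Lemma dmfD c v s f g : cdom c s -> smooth_at s f -> smooth_at s g ->
  @dmf c v (fun t => f t + g t) s = dmf v f s + dmf v g s.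
Proof.
move=> cs hf hg; apply: dmf_unique.
exact: (cderD (dmf_cderP v cs hf) (dmf_cderP v cs hg)).
Qed.

Lemma dmfM c v s f g : cdom c s -> smooth_at s f -> smooth_at s g ->
  @dmf c v (fun t => f t * g t) s = dmf v f s * g s + f s * dmf v g s.
Proof.
move=> cs hf hg; apply: dmf_unique.
have := cderM (dmf_cderP v cs hf) (dmf_cderP v cs hg).
by rewrite !line_at0 coordK //; exact.
Qed.

Lemma dmf_conj c v s f : cdom c s -> smooth_at s f ->
  @dmf c v (fun t => (f t)^*) s = (dmf v f s)^*.
Proof. by move=> cs hf; apply: dmf_unique; exact: (cder_conj (dmf_cderP v cs hf)). Qed.

Lemma smooth_at_C1 c s f : cdom c s -> smooth_at s f ->
  C1_at (fun x => f (coordV x)) (Defs.coord c s).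
Proof.
move=> cs [ O [oO Os] hf].
exact: (Ck_on_C1 (open_coord_image oO) (hf c 1%N) (imageP _ (conj Os cs))).
Qed.

Lemma dmfDv c v w s f : cdom c s -> smooth_at s f ->
  @dmf c (v + w) f s = dmf v f s + dmf w f s.
Proof. by move=> cs hf; apply: rderiveDv; exact: smooth_at_C1. Qed.

Lemma dmfZv c (a : R) v s f : cdom c s -> smooth_at s f ->
  @dmf c (ofR a *: v) f s = ofR a * dmf v f s.
Proof. by move=> cs hf; apply: rderiveZv; exact: smooth_at_C1. Qed.

Lemma dmf_sum c v s (J : Type) (r : seq J) (f : J -> S -> C) : cdom c s ->
  (forall j, smooth_at s (f j)) ->
  @dmf c v (fun t => \sum_(j <- r) f j t) s = \sum_(j <- r) dmf v (f j) s.
Proof.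
move=> cs hf; elim: r => [|j r IH].
  by rewrite big_nil; under eq_fun do rewrite big_nil; exact: dmf_cst.
rewrite big_cons -IH; under eq_fun do rewrite big_cons.
by apply: dmfD => //; exact: smooth_at_sum.
Qed.

(** The chain rule for the transition map: the derivative does not depend on the
    chart that represents the tangent vector. *)
Lemma dmf_transition c c' v s f : cdom c s -> cdom c' s -> smooth_at s f ->
  @dmf c' (tangent_transition c' s v) f s = @dmf c v f s.
Proof.
move=> cs cs' hf; apply/esym/dmf_unique.
pose g (t : R) := Defs.coord c' (@coordV _ _ M c (Defs.coord c s + ofR t *: v)).
have g0 : g 0 = Defs.coord c' s by rewrite /g scale0r addr0 coordK.
have H := @chain_rule R _ (fun x => f (@coordV _ _ M c' x)) g (tangent_transition c' s v).
rewrite g0 in H.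
apply: cder_near (H _ _).
- rewrite /g.
  have := near_coordV cs (nbhs_cdom cs').
  move=> /(@near_line _ _ _ _ v); apply: filterS => t ct.
  by rewrite /line_at coordK.
- exact: smooth_at_C1.
- move=> j; rewrite mxE.
  have [h _] := @transition_holomorphic _ _ M c c' j.
  exact: (Ck_on_cder v (h 1%N) (imageP _ (conj cs cs'))).
Qed.

(** The Cauchy-Riemann equations of the transition maps. *)
Lemma tangent_transition_i c c' s v : cdom c s -> cdom c' s ->
  @tangent_transition _ _ M c c' s ('i *: v) = 'i *: tangent_transition c' s v.
Proof.
move=> cs cs'; apply/rowP => j; rewrite !mxE.
have [_ h] := @transition_holomorphic _ _ M c c' j.
have := h (Defs.coord c s) v (imageP _ (conj cs cs')).
rewrite /dbar => /eqP; rewrite mulf_eq0 invr_eq0 pnatr_eq0 /= => /eqP E.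
set a := rderive v _ _ in E *; set b := rderive ('i *: v) _ _ in E *.
have -> : b = - 'i * (a + 'i * b) + 'i * a.
  have ii : 'i * 'i = -1 :> C by rewrite -expr2 sqrCi.
  by rewrite mulrDr !mulNr mulrA ii mulN1r opprK; ring.
by rewrite E mulr0 add0r.
Qed.

End Germs.

(** * Smooth matrices *)

Section RankAlgebra.
Variable K : fieldType.

(** As P B Q is invertible and B has rank at most r, the r rows of P B are a basis of
    the row space of B; so B = Y P B, and multiplying by Q gives Y. *)
Lemma rank_factor m p r (B : 'M[K]_(m, p)) (P : 'M[K]_(r, m)) (Q : 'M[K]_(p, r)) :
  (\rank B <= r)%N -> P *m B *m Q \in unitmx ->
  B = B *m Q *m invmx (P *m B *m Q) *m (P *m B).
Proof.
move=> Br PBQ.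
have rPB : \rank (P *m B) = r.
  apply/eqP; rewrite eqn_leq rank_leq_row /=.
  by rewrite -[X in (X <= _)%N](mxrank_unit PBQ) mxrankM_maxl.
have PB : (P *m B <= B)%MS by exact: submxMl.
have /submxP[Y BE] : (B <= P *m B)%MS.
  by rewrite -(mxrank_leqif_sup PB).2 rPB eqn_leq -{1}rPB mxrankS.
have -> : B *m Q = Y *m (P *m B *m Q) by rewrite mulmxA -BE.
by rewrite mulmxK.
Qed.
End RankAlgebra.

Section SmoothMatrices.
Variables (R : realType) (S : topologicalType) (M : complex_manifold R S).
Local Notation C := (Cx R).
Local Notation ofR t := (((t : R)%:C)%C : Cx R).
Implicit Types (s : S) (c : chart M).

Definition smooth_mx m n s (A : S -> 'M[C]_(m, n)) :=
  forall i j, smooth_at M s (fun t => A t i j).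

Lemma smooth_mx_cst m n s (A : 'M[C]_(m, n)) : smooth_mx s (fun=> A).
Proof. by move=> i j; exact: smooth_at_cst. Qed.

Lemma smooth_mx_eq m n s (A B : S -> 'M[C]_(m, n)) :
  (\forall t \near s, A t = B t) -> smooth_mx s A -> smooth_mx s B.
Proof. by move=> AB hA i j; apply: smooth_at_eq (hA i j); apply: filterS AB => t ->. Qed.

Lemma smooth_mx_near m n s (A : S -> 'M[C]_(m, n)) : smooth_mx s A ->
  \forall t \near s, smooth_mx t A.
Proof.
move=> hA; apply: filter_forall => i; apply: filter_forall => j.
exact: smooth_at_near.
Qed.

Lemma smooth_mxD m n s (A B : S -> 'M[C]_(m, n)) : smooth_mx s A -> smooth_mx s B ->
  smooth_mx s (fun t => A t + B t).
Proof.
by move=> hA hB i j; under eq_fun do rewrite mxE; exact: smooth_atD.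
Qed.

Lemma smooth_mxM m n p s (A : S -> 'M[C]_(m, n)) (B : S -> 'M[C]_(n, p)) :
  smooth_mx s A -> smooth_mx s B -> smooth_mx s (fun t => A t *m B t).
Proof.
move=> hA hB i j; under eq_fun do rewrite mxE.
by apply: smooth_at_sum => k; exact: smooth_atM.
Qed.

Lemma smooth_mxZ m n s (a : C) (A : S -> 'M[C]_(m, n)) : smooth_mx s A ->
  smooth_mx s (fun t => a *: A t).
Proof.
move=> hA i j; under eq_fun do rewrite mxE.
by apply: smooth_atM => //; exact: smooth_at_cst.
Qed.

Lemma smooth_mx_conj m n s (A : S -> 'M[C]_(m, n)) : smooth_mx s A ->
  smooth_mx s (fun t => map_mx Num.conj (A t)).
Proof. by move=> hA i j; under eq_fun do rewrite mxE; exact: smooth_at_conj. Qed.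

Lemma smooth_mx_lsub m n1 n2 s (A : S -> 'M[C]_(m, n1 + n2)) : smooth_mx s A ->
  smooth_mx s (fun t => lsubmx (A t)).
Proof. by move=> hA i j; under eq_fun do rewrite mxE; exact: hA. Qed.

Lemma smooth_mx_col m1 m2 n s (A : S -> 'M[C]_(m1, n)) (B : S -> 'M[C]_(m2, n)) :
  smooth_mx s A -> smooth_mx s B -> smooth_mx s (fun t => col_mx (A t) (B t)).
Proof.
move=> hA hB i j; case: (split_ordP i) => k ->.
  by under eq_fun do rewrite col_mxEu; exact: hA.
by under eq_fun do rewrite col_mxEd; exact: hB.
Qed.

Lemma smooth_at_det n s (A : S -> 'M[C]_n) : smooth_mx s A ->
  smooth_at M s (fun t => \det (A t)).
Proof.
move=> hA; rewrite /determinant; apply: smooth_at_sum => p.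
apply: smooth_atM; first exact: smooth_at_cst.
by apply: smooth_at_prod => i; exact: hA.
Qed.

Lemma smooth_mx_adj n s (A : S -> 'M[C]_n) : smooth_mx s A ->
  smooth_mx s (fun t => \adj (A t)).
Proof.
move=> hA i j; under eq_fun do rewrite mxE /cofactor.
apply: smooth_atM; first exact: smooth_at_cst.
apply: smooth_at_det => k l; under eq_fun do rewrite !mxE; exact: hA.
Qed.

Lemma unitmx_near n s (A : S -> 'M[C]_n) : smooth_mx s A -> A s \in unitmx ->
  \forall t \near s, A t \in unitmx.
Proof.
move=> /smooth_at_det hA; rewrite unitmxE unitfE => /(smooth_at_neq0 hA).
by apply: filterS => t; rewrite unitmxE unitfE.
Qed.

Lemma smooth_mx_inv n s (A : S -> 'M[C]_n) : smooth_mx s A -> A s \in unitmx ->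
  smooth_mx s (fun t => invmx (A t)).
Proof.
move=> hA uA; apply: (@smooth_mx_eq _ _ _ (fun t => (\det (A t))^-1 *: \adj (A t))).
  by apply: filterS (unitmx_near hA uA) => t; rewrite /invmx => ->.
move=> i j; under eq_fun do rewrite mxE; apply: smooth_atM; last exact: smooth_mx_adj.
apply: smooth_atV; first exact: smooth_at_det.
by rewrite -unitfE -unitmxE.
Qed.

(** * Frames and kernels of smooth matrices *)

(** A right inverse of A s stays a right inverse of A t up to an invertible
    factor. *)
Lemma row_free_near m n s (A : S -> 'M[C]_(m, n)) : smooth_mx s A ->
  row_free (A s) -> \forall t \near s, row_free (A t).
Proof.
move=> hA fA.
have := @unitmx_near _ s (fun t => A t *m pinvmx (A s)).
rewrite mulmxVp // => /(_ (smooth_mxM hA (smooth_mx_cst s _)) (unitmx1 _ _)).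
apply: filterS => t U; rewrite -kermx_eq0; apply/eqP.
have : kermx (A t) *m (A t *m pinvmx (A s)) = 0 by rewrite mulmxA mulmx_ker mul0mx.
by move/(congr1 (mulmx^~ (invmx (A t *m pinvmx (A s))))); rewrite mulmxK // mul0mx.
Qed.

(** With Q a right inverse of A s, sigma = g A gives sigma Q = g (A Q), where A Q is
    invertible near s; so g is a smooth function of sigma and A. *)
Lemma frame_coef p m n s (A : S -> 'M[C]_(m, n)) (sigma : S -> 'M[C]_(p, n)) :
  smooth_mx s A -> row_free (A s) -> smooth_mx s sigma ->
  (\forall t \near s, (sigma t <= A t)%MS) ->
  exists2 g : S -> 'M[C]_(p, m), smooth_mx s g &
    \forall t \near s, sigma t = g t *m A t.
Proof.
move=> hA fA hs sA; pose Q := pinvmx (A s).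
have hAQ : smooth_mx s (fun t => A t *m Q) by apply: smooth_mxM => //; exact: smooth_mx_cst.
have uAQ : A s *m Q \in unitmx by rewrite mulmxVp // unitmx1.
exists (fun t => sigma t *m Q *m invmx (A t *m Q)).
  apply: smooth_mxM; last exact: smooth_mx_inv.
  by apply: smooth_mxM => //; exact: smooth_mx_cst.
apply: filterS2 sA (unitmx_near hAQ uAQ) => t /submxP[x ->] U.
by rewrite -(mulmxA x) mulmxK.
Qed.

(** Vectors in the kernel extend to smooth local sections of the kernel when the
    rank is locally constant. With P and Q such that P B(s) Q = 1, the section
    x0 - x0 B Q (P B Q)^-1 P is killed by B because of [rank_factor]. *)
Lemma smooth_kernel m p s (B : S -> 'M[C]_(m, p)) (x0 : 'rV[C]_m) :
  smooth_mx s B -> (\forall t \near s, \rank (B t) = \rank (B s)) ->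
  x0 *m B s = 0 ->
  exists x : S -> 'rV[C]_m, [/\ smooth_mx s x, x s = x0 &
    \forall t \near s, x t *m B t = 0].
Proof.
move=> hB rB xB.
pose P := pinvmx (col_base (B s)); pose Q := pinvmx (row_base (B s)).
have E : P *m B s *m Q = 1%:M.
  transitivity (P *m (col_base (B s) *m row_base (B s)) *m Q).
    by rewrite mulmx_base.
  rewrite mulmxA mulVpmx ?col_base_full // mul1mx mulmxVp //; exact: row_base_free.
have hPBQ : smooth_mx s (fun t => P *m B t *m Q).
  by apply: smooth_mxM; [apply: smooth_mxM => //|]; exact: smooth_mx_cst.
have uPBQ : P *m B s *m Q \in unitmx by rewrite E unitmx1.
exists (fun t => x0 + - 1 *: (x0 *m (B t *m Q) *m invmx (P *m B t *m Q) *m P)); split.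
- apply: smooth_mxD; first exact: smooth_mx_cst.
  apply: smooth_mxZ; apply: smooth_mxM; last exact: smooth_mx_cst.
  apply: smooth_mxM; last exact: smooth_mx_inv.
  apply: smooth_mxM; first exact: smooth_mx_cst.
  by apply: smooth_mxM => //; exact: smooth_mx_cst.
- by rewrite mulmxA xB !mul0mx scaler0 addr0.
- apply: filterS2 rB (unitmx_near hPBQ uPBQ) => t rt U.
  rewrite mulmxDl -scalemxAl scaleN1r -!mulmxA.
  have {1}-> : B t = B t *m Q *m invmx (P *m B t *m Q) *m (P *m B t).
    by apply: rank_factor => //; rewrite rt.
  by rewrite !mulmxA subrr.
Qed.

(** The intersection of two row spaces is the image of the kernel of the matrix
    obtained by stacking A on B. *)
Lemma smooth_capmx a b n s (A : S -> 'M[C]_(a, n)) (B : S -> 'M[C]_(b, n)) (u0 : 'rV[C]_n) :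
  smooth_mx s A -> smooth_mx s B ->
  (\forall t \near s, \rank (col_mx (A t) (B t)) = \rank (col_mx (A s) (B s))) ->
  (u0 <= A s)%MS -> (u0 <= B s)%MS ->
  exists u : S -> 'rV[C]_n, [/\ smooth_mx s u, u s = u0 &
    \forall t \near s, (u t <= A t)%MS /\ (u t <= B t)%MS].
Proof.
move=> hA hB rAB /submxP[x0 xE] /submxP[y0 yE].
have xyK : row_mx x0 (- y0) *m col_mx (A s) (B s) = 0.
  by rewrite mul_row_col mulNmx -xE -yE subrr.
have [z [hz zs zt]] := smooth_kernel (smooth_mx_col hA hB) rAB xyK.
exists (fun t => lsubmx (z t) *m A t); split.
- by apply: smooth_mxM => //; exact: smooth_mx_lsub.
- by rewrite zs row_mxKl -xE.
- apply: filterS zt => t zt; split; first exact: submxMl.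
  move: zt; rewrite -[z t]hsubmxK mul_row_col row_mxKl => /eqP.
  by rewrite addr_eq0 => /eqP ->; rewrite -mulNmx submxMl.
Qed.

(** The components in a direct sum are read off from the coefficients in the
    joined frame. *)
Lemma smooth_proj a b p n s (A : S -> 'M[C]_(a, n)) (B : S -> 'M[C]_(b, n))
    (u v : S -> 'M[C]_(p, n)) :
  smooth_mx s A -> smooth_mx s B -> row_free (col_mx (A s) (B s)) ->
  (\forall t \near s, (u t <= A t)%MS) -> (\forall t \near s, (v t <= B t)%MS) ->
  smooth_mx s (fun t => u t + v t) -> smooth_mx s u.
Proof.
move=> hA hB fAB uA vB huv.
have hAB := smooth_mx_col hA hB.
have [|g hg gE] := frame_coef hAB fAB huv.
  apply: filterS2 uA vB => t /submxP[x ->] /submxP[y ->].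
  by rewrite -mul_row_col submxMl.
apply: (@smooth_mx_eq _ _ _ (fun t => lsubmx (g t) *m A t)); last first.
  by apply: smooth_mxM => //; exact: smooth_mx_lsub.
near=> t.
have /submxP[x xE] : (u t <= A t)%MS by near: t.
have /submxP[y yE] : (v t <= B t)%MS by near: t.
have /row_free_inj fr : row_free (col_mx (A t) (B t)) by near: t; exact: row_free_near.
have E : u t + v t = g t *m col_mx (A t) (B t) by near: t.
have -> : g t = row_mx x y by apply: fr; rewrite /= -E mul_row_col -xE -yE.
by rewrite row_mxKl -xE.
Unshelve. all: by end_near. Qed.

(** * Derivatives of smooth matrices *)
Definition dmx m n c (v : 'rV[C]_(cdim c)) (A : S -> 'M[C]_(m, n)) s : 'M[C]_(m, n) :=
  \matrix_(i, j) dmf v (fun t => A t i j) s.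

Lemma dmxM m n p c v s (A : S -> 'M[C]_(m, n)) (B : S -> 'M[C]_(n, p)) :
  cdom c s -> smooth_mx s A -> smooth_mx s B ->
  @dmx _ _ c v (fun t => A t *m B t) s = dmx v A s *m B s + A s *m dmx v B s.
Proof.
move=> cs hA hB; apply/matrixP => i j; rewrite !mxE -big_split /=.
under [in LHS]eq_fun do rewrite mxE.
rewrite dmf_sum //; last by move=> k; exact: smooth_atM.
by apply: eq_bigr => k _; rewrite dmfM // !mxE.
Qed.

Lemma dmxD m n c v s (A B : S -> 'M[C]_(m, n)) :
  cdom c s -> smooth_mx s A -> smooth_mx s B ->
  @dmx _ _ c v (fun t => A t + B t) s = dmx v A s + dmx v B s.
Proof.
move=> cs hA hB; apply/matrixP => i j; rewrite !mxE.
by under [in LHS]eq_fun do rewrite mxE; exact: dmfD.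
Qed.

Lemma dmx_cst m n c v s (A : 'M[C]_(m, n)) : @dmx _ _ c v (fun=> A) s = 0.
Proof. by apply/matrixP => i j; rewrite !mxE dmf_cst. Qed.

Lemma dmx_eq m n c v s (A B : S -> 'M[C]_(m, n)) :
  cdom c s -> smooth_mx s A -> (\forall t \near s, A t = B t) ->
  @dmx _ _ c v A s = dmx v B s.
Proof.
move=> cs hA AB; apply/matrixP => i j; rewrite !mxE; apply: dmf_eq => //.
by apply: filterS AB => t ->.
Qed.

Lemma dmx_conj m n c v s (A : S -> 'M[C]_(m, n)) : cdom c s -> smooth_mx s A ->
  @dmx _ _ c v (fun t => map_mx Num.conj (A t)) s = map_mx Num.conj (dmx v A s).
Proof.
move=> cs hA; apply/matrixP => i j; rewrite !mxE.
by under [in LHS]eq_fun do rewrite mxE; exact: dmf_conj.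
Qed.

Lemma smooth_mx_dmx m n c v s (A : S -> 'M[C]_(m, n)) : cdom c s -> smooth_mx s A ->
  smooth_mx s (@dmx _ _ c v A).
Proof.
move=> cs hA i j; under eq_fun do rewrite mxE; exact: smooth_at_dmf.
Qed.

Lemma dmxDv m n c v w s (A : S -> 'M[C]_(m, n)) : cdom c s -> smooth_mx s A ->
  @dmx _ _ c (v + w) A s = dmx v A s + dmx w A s.
Proof. by move=> cs hA; apply/matrixP => i j; rewrite !mxE dmfDv. Qed.

Lemma dmxZv m n c (a : R) v s (A : S -> 'M[C]_(m, n)) : cdom c s -> smooth_mx s A ->
  @dmx _ _ c (ofR a *: v) A s = ofR a *: dmx v A s.
Proof. by move=> cs hA; apply/matrixP => i j; rewrite !mxE dmfZv. Qed.

Lemma dmx_transition m n c c' v s (A : S -> 'M[C]_(m, n)) :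
  cdom c s -> cdom c' s -> smooth_mx s A ->
  @dmx _ _ c' (tangent_transition c' s v) A s = @dmx _ _ c v A s.
Proof. by move=> cs cs' hA; apply/matrixP => i j; rewrite !mxE dmf_transition. Qed.

End SmoothMatrices.

(** * Subspaces of row vectors and extension of scalars *)

Section Spans.
Variables (K : fieldType) (n : nat).

(** Vector subspaces are compared with row spaces of matrices, for which ranks,
    kernels and smooth dependence are available. *)
Definition seq_mx (s : seq 'rV[K]_n) : 'M[K]_(size s, n) := \matrix_(i, j) (s`_i) 0 j.

Lemma row_seq_mx s i : row i (seq_mx s) = s`_i.
Proof. by apply/rowP => j; rewrite !mxE. Qed.

Lemma memv_spanE (s : seq 'rV[K]_n) u : (u \in span s) = (u <= seq_mx s)%MS.
Proof.
apply/idP/idP => [us|/submxP[x ->]].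
  have := @coord_span _ _ _ (in_tuple s) u us => ->.
  apply: summx_sub => i _; apply: scalemx_sub.
  by rewrite /= -row_seq_mx row_sub.
rewrite mulmx_sum_row; apply: memv_suml => i _; apply: memvZ.
by rewrite row_seq_mx memv_span // mem_nth.
Qed.

Lemma row_free_tuple m (X : m.-tuple 'rV[K]_n) (A : 'M[K]_(m, n)) :
  free X -> (forall i, row i A = X`_i) -> row_free A.
Proof.
move=> fX AX; rewrite -kermx_eq0; apply/eqP/row_matrixP => i; rewrite row0.
set x := row i _; have : x *m A = 0 by rewrite -row_mul mulmx_ker row0.
rewrite mulmx_sum_row => H; apply/rowP => j; rewrite [RHS]mxE.
move/freeP: fX => /(_ (fun i => x 0 i)); apply.
by rewrite -[RHS]H; apply: eq_bigr => k _; rewrite AX.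
Qed.

Lemma row_free_seq_mx s : free s -> row_free (seq_mx s).
Proof.
move=> fs; apply: (row_free_tuple (X := in_tuple s)) => // i.
by rewrite row_seq_mx.
Qed.

Lemma dim_rank m (V : {vspace 'rV[K]_n}) (A : 'M[K]_(m, n)) :
  (forall u, (u \in V) = (u <= A)%MS) -> \dim V = \rank A.
Proof.
move=> VA; have fB := row_free_seq_mx (basis_free (vbasisP V)).
have dV : \dim V = \rank (seq_mx (vbasis V)).
  by move: fB => /eqP ->; rewrite size_tuple.
apply: (etrans dV); apply/eqP; rewrite eqn_leq.
by apply/andP; split; apply: mxrankS; apply/rV_subP => u;
  rewrite -VA -memv_spanE (span_basis (vbasisP V)).
Qed.

Lemma memv_vbasis (V : {vspace 'rV[K]_n}) u : (u \in V) = (u <= seq_mx (vbasis V))%MS.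
Proof. by rewrite -memv_spanE (span_basis (vbasisP V)). Qed.

Lemma row_free_memv m (V : {vspace 'rV[K]_n}) (A : 'M[K]_(m, n)) :
  (forall i, row i A \in V) -> row_free A -> \dim V = m ->
  forall u, (u \in V) = (u <= A)%MS.
Proof.
move=> AV /eqP rA dV u; set b := seq_mx (vbasis V).
have Ab : (A <= b)%MS by apply/row_subP => i; rewrite -memv_vbasis.
have bA : (b <= A)%MS.
  by rewrite -(mxrank_leqif_sup Ab).2 rA -(dim_rank (memv_vbasis V)) dV.
by rewrite memv_vbasis -/b; apply/idP/idP => h; apply: submx_trans h _.
Qed.

Lemma rank_col_mx m1 m2 (A1 : 'M[K]_(m1, n)) (A2 : 'M[K]_(m2, n))
    (B1 B2 : {vspace 'rV[K]_n}) :
  (forall u, (u \in B1) = (u <= A1)%MS) -> (forall u, (u \in B2) = (u <= A2)%MS) ->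
  \rank (col_mx A1 A2) = \dim (B1 + B2).
Proof.
move=> E1 E2; rewrite -addsmxE; apply/esym/dim_rank => w.
apply/idP/idP.
  move=> /memv_addP[w1 w1B [w2 w2B ->]]; rewrite E1 in w1B; rewrite E2 in w2B.
  by apply: addmx_sub_adds.
move=> /sub_addsmxP[[x y] /= ->]; apply: memv_add.
  by rewrite E1 submxMl.
by rewrite E2 submxMl.
Qed.

Lemma memv_mulmx m (x : 'rV[K]_m) (A : 'M[K]_(m, n)) (X : {vspace 'rV[K]_n}) :
  (forall i, row i A \in X) -> x *m A \in X.
Proof. by move=> AX; rewrite mulmx_sum_row; apply: memv_suml => i _; exact: memvZ. Qed.

Lemma dim_row_space : \dim (fullv : {vspace 'rV[K]_n}) = n.
Proof.
by rewrite (@dim_rank _ fullv 1%:M) ?mxrank1 // => u; rewrite memvf submx1.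
Qed.

End Spans.

Section ScalarExtension.
Variables (K L : fieldType) (f : {rmorphism K -> L}) (n : nat).

Lemma seq_mx_map (s : seq 'rV[K]_n) (u : 'rV[L]_n) :
  (u <= seq_mx [seq map_mx f v | v <- s])%MS = (u <= map_mx f (seq_mx s))%MS.
Proof.
apply/idP/idP => /submx_trans -> //; apply/row_subP => i.
  have ltis : (i < size s)%N by rewrite -(size_map (map_mx f) s).
  rewrite row_seq_mx (nth_map 0) //.
  have -> : s`_i = row (Ordinal ltis) (seq_mx s) by rewrite row_seq_mx.
  by rewrite map_row row_sub.
rewrite -map_row row_seq_mx -memv_spanE; apply: memv_span.
by apply: map_f; exact: mem_nth.
Qed.

Lemma mem_ext_space (U : {vspace 'rV[K]_n}) u :
  (u \in ext_space f U) = (u <= map_mx f (seq_mx (vbasis U)))%MS.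
Proof. by rewrite memv_spanE seq_mx_map. Qed.

(** Ranks do not change under extension of the field. *)
Lemma dim_ext_space (U : {vspace 'rV[K]_n}) : \dim (ext_space f U) = \dim U.
Proof.
transitivity (\rank (seq_mx (vbasis U))).
  by rewrite (dim_rank (mem_ext_space U)) mxrank_map.
by apply/esym/dim_rank => u; exact: memv_vbasis.
Qed.

Lemma mem_ext_map (U : {vspace 'rV[K]_n}) u :
  (map_mx f u \in ext_space f U) = (u \in U).
Proof. by rewrite mem_ext_space map_submx memv_vbasis. Qed.

End ScalarExtension.

Section Conjugation.
Variables (R : realType) (n : nat).
Local Notation C := (Cx R).
Implicit Types (U : {vspace 'rV[C]_n}) (W : {vspace 'rV[rat]_n}).

Definition cmx m (u : 'M[C]_(m, n)) : 'M[C]_(m, n) := map_mx Num.conj u.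

Lemma cmxK m : involutive (@cmx m).
Proof. by move=> u; apply/matrixP => i j; rewrite !mxE conjCK. Qed.

Lemma mem_conj_space U u : (u \in conj_space U) = (cmx u \in U).
Proof.
by rewrite -{1}(cmxK u) /conj_space (@mem_ext_map _ _ Num.conj).
Qed.

Lemma complexifyS W W' :
  (W <= W')%VS -> (complexify R W <= complexify R W')%VS.
Proof.
move=> WW'; apply/span_subvP => _ /mapP[w wW ->].
rewrite (@mem_ext_map _ _ (ratr : {rmorphism rat -> C})).
by apply: (subvP WW'); exact: vbasis_mem.
Qed.

Lemma complexify0 : complexify R (0%VS : {vspace 'rV[rat]_n}) = 0%VS.
Proof.
apply/eqP; rewrite -dimv_eq0 /complexify (@dim_ext_space _ _ (ratr : {rmorphism rat -> C})).
by rewrite dimv0.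
Qed.

End Conjugation.

(** * Direct sums and projections *)

Section Projections.
Variables (K : fieldType) (E : vectType K).
Implicit Types (U W : {vspace E}) (w : E).

Lemma daddv_pi_off U W w : (U :&: W = 0)%VS -> w \in W -> daddv_pi U W w = 0.
Proof.
move=> UW wW; have WU : (W :&: U = 0)%VS by rewrite capvC.
have := daddv_pi_add UW (subvP (addvSr U W) _ wW).
by rewrite (daddv_pi_id WU wW) -[X in _ = X]add0r => /addIr.
Qed.

Lemma daddv_pi_split U1 W1 U2 W2 w :
  (U1 :&: W1 = 0)%VS -> (U2 :&: W2 = 0)%VS -> (U2 <= W1)%VS -> (U1 <= W2)%VS ->
  w \in (U1 + U2)%VS -> w = daddv_pi U1 W1 w + daddv_pi U2 W2 w.
Proof.
move=> h1 h2 s1 s2 /memv_addP[x xU [y yU ->]]; rewrite !linearD /=.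
rewrite (daddv_pi_id h1 xU) (daddv_pi_id h2 yU).
by rewrite (daddv_pi_off h1 (subvP s1 _ yU)) (daddv_pi_off h2 (subvP s2 _ xU)) addr0 add0r.
Qed.
End Projections.

Section DirectFamilies.
Variables (K : fieldType) (E : vectType K) (T : choiceType) (I : T -> {vspace E}).
Variable s : seq T.
Hypotheses (us : uniq s) (Is : forall t, t \notin s -> I t = 0%VS)
  (ds : directv (\sum_(t <- s) I t)) (fs : (\sum_(t <- s) I t)%VS = fullv).
Implicit Types P Q : pred T.

Definition isum P := (\sum_(t <- s | P t) I t)%VS.

Lemma sum_over_isum (A : set T) : sum_over A I = isum (fun t => t \in A).
Proof.
rewrite /sum_over /isum (bigfs (idx := 0%VS) _ us (fun t _ => @Is t)).
by congr (\big[_/_]_(t \in _) _); apply/seteqP; split => t /=; rewrite inE.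
Qed.

Lemma sum_over_pred (b : pred T) : sum_over [set t | b t] I = isum b.
Proof.
rewrite sum_over_isum; apply: eq_bigl => t.
by apply/idP/idP; rewrite in_setE.
Qed.

Lemma sub_isum P t : P t -> (I t <= isum P)%VS.
Proof.
move=> Pt; have [ts|/Is ->] := boolP (t \in s); last exact: sub0v.
rewrite /isum -big_filter; have : t \in [seq x <- s | P x] by rewrite mem_filter Pt.
by move=> tf; rewrite (big_rem t tf) /= addvSl.
Qed.

Lemma isum_sub P U : (forall t, P t -> (I t <= U)%VS) -> (isum P <= U)%VS.
Proof.
move=> H; rewrite /isum; elim/big_ind: _ => [|U1 U2 h1 h2|t /H //]; first exact: sub0v.
by rewrite subv_add h1.
Qed.

Lemma isumS P Q : (forall t, P t -> Q t) -> (isum P <= isum Q)%VS.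
Proof. by move=> PQ; apply: isum_sub => t /PQ /sub_isum. Qed.

Lemma eq_isum P Q : P =1 Q -> isum P = isum Q.
Proof. by move=> PQ; rewrite /isum; apply: eq_bigl. Qed.

Lemma isumT : isum predT = fullv.
Proof. exact: fs. Qed.

Lemma isumU P Q : isum (predU P Q) = (isum P + isum Q)%VS.
Proof.
apply/eqP; rewrite eqEsubv; apply/andP; split; last first.
  by rewrite subv_add; apply/andP; split; apply: isumS => t /= ->; rewrite ?orbT.
apply: isum_sub => t /orP[] Pt; apply: subv_trans (sub_isum Pt) _.
  exact: addvSl.
exact: addvSr.
Qed.

(** All computations with a direct decomposition come from this formula: the upper
    bound is clear, and it is sharp for P because the total dimension is split
    between P and its complement. *)
Lemma dim_isum P : \dim (isum P) = (\sum_(t <- s | P t) \dim (I t))%N.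
Proof.
have le Q : (\dim (isum Q) <= \sum_(t <- s | Q t) \dim (I t))%N.
  rewrite /isum; elim/big_rec2: _ => [|t d U _ h]; first by rewrite dimv0.
  by apply: leq_trans (dimv_add_leqif _ _) _; rewrite leq_add2l.
apply/eqP; rewrite eqn_leq le /=.
have tot : \dim (isum predT) = (\sum_(t <- s) \dim (I t))%N.
  by move: ds; rewrite directvE /= => /eqP.
have := dimv_add_leqif (isum P) (isum (predC P)).
rewrite -isumU (eq_isum (_ : _ =1 predT)); last by move=> t /=; rewrite orbN.
move=> [+ _]; rewrite tot (bigID P) /= => h.
rewrite -(leq_add2r (\sum_(i <- s | ~~ P i) \dim (I i))); apply: leq_trans h _.
by rewrite leq_add2l; exact: le.
Qed.

(** The intersection contains the sum over the common indices, and has the same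
    dimension. *)
Lemma isumI P Q : (isum P :&: isum Q)%VS = isum (predI P Q).
Proof.
apply/esym/eqP; rewrite eqEdim; apply/andP; split.
  by rewrite subv_cap; apply/andP; split; apply: isumS => t /andP[].
rewrite -(leq_add2l (\dim (isum P + isum Q))) dimv_sum_cap -isumU !dim_isum.
rewrite ![(\sum_(t <- s | _) _)%N]big_mkcond -!big_split /=.
apply: leq_sum => t _; rewrite /predU /predI /=.
by case: (P t); case: (Q t); rewrite ?addn0 ?add0n //.
Qed.

Lemma isum_disjoint P Q : (forall t, P t -> ~~ Q t) -> (isum P :&: isum Q)%VS = 0%VS.
Proof.
move=> PQ; rewrite isumI /isum big_pred0 // => t /=.
by apply/negP => /andP[/PQ /negP].
Qed.

Lemma isum_memP P u (Z : E -> Prop) : u \in isum P -> Z 0 ->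
  (forall x y, Z x -> Z y -> Z (x + y)) ->
  (forall t x, P t -> x \in I t -> Z x) -> Z u.
Proof.
move=> + Z0 ZD ZI; rewrite /isum; elim: s u => [|t r IH] u.
  by rewrite big_nil memv0 => /eqP ->.
rewrite big_cons; case: ifP => [Pt|_]; last exact: IH.
by move=> /memv_addP[x xI [y yr ->]]; apply: ZD; [exact: ZI xI|exact: IH].
Qed.

(** With f the first index, this is the decomposition into the U^p. *)
Lemma direct_fibres (T' : choiceType) (f : T -> T') :
  direct_decomposition (fun p => isum (fun t => f t == p)).
Proof.
set ps := undup [seq f t | t <- s].
have full : (\sum_(p <- ps) isum (fun t => f t == p))%VS = fullv.
  apply/eqP; rewrite eqEsubv subvf /= -isumT; apply: isum_sub => t _.
  have [ts|/Is ->] := boolP (t \in s); last exact: sub0v.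
  have fps : f t \in ps by rewrite mem_undup; exact: map_f.
  by rewrite (big_rem _ fps) /=; apply: subv_trans (addvSl _ _); exact: sub_isum.
exists ps; split.
- exact: undup_uniq.
- move=> p pns; apply/eqP; rewrite -subv0; apply: isum_sub => t /eqP ft.
  have [ts|/Is ->] := boolP (t \in s); last exact: sub0v.
  by case/negP: pns; rewrite mem_undup -ft; exact: map_f.
- rewrite directvE /= full; apply/eqP/esym.
  transitivity (\sum_(p <- ps) \sum_(t <- s) if f t == p then \dim (I t) else 0)%N.
    by apply: eq_bigr => p _; rewrite dim_isum big_mkcond.
  rewrite exchange_big /= -isumT dim_isum big_seq [RHS]big_seq.
  apply: eq_bigr => t ts; rewrite -big_mkcond /=.
  under eq_bigl do rewrite eq_sym.
  rewrite -big_filter filter_pred1_uniq ?big_seq1 ?undup_uniq //.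
  by rewrite mem_undup; exact: map_f.
- exact: full.
Qed.
End DirectFamilies.

(** * The Deligne bigrading of one mixed Hodge structure *)

Section DeligneBigrading.
Variables (R : realType) (n : nat).
Local Notation C := (Cx R).
Variables (F : int -> {vspace 'rV[C]_n}) (W : int -> {vspace 'rV[rat]_n}).
Variable (I : int * int -> {vspace 'rV[C]_n}).
Hypothesis hI : deligne_bigrading F W I.

Definition Uspace p : {vspace 'rV[C]_n} := sum_over [set: int] (fun q => I (p, q)).
(** The increasing filtration opposite to F. *)
Definition Phi p : {vspace 'rV[C]_n} := sum_over [set x | x.1 <= p] I.
(** The complement of U^p formed by all the other U^q. *)
Definition Ucompl p : {vspace 'rV[C]_n} := (F (p + 1)%R + Phi (p - 1)%R)%VS.

(** All the subspaces at hand are sums of I^(p,q) over sets of indices, so that the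
    lattice identities below reduce to integer arithmetic. *)
Lemma deligne_data : exists s : seq (int * int),
  [/\ [/\ uniq s, (forall t, t \notin s -> I t = 0%VS),
     directv (\sum_(t <- s) I t) & (\sum_(t <- s) I t)%VS = fullv],
   (forall p, F p = isum I s (fun x => p <= x.1)) /\
   (forall k, complexify R (W k) = isum I s (fun x => x.1 + x.2 <= k)),
   forall p, Phi p = isum I s (fun x => x.1 <= p),
   forall p, Uspace p = isum I s (fun x => x.1 == p) &
   forall a b, let J := isum I s (fun x => (x.1 < b) && (x.2 < a)) in
     (conj_space (I (a, b)) + J)%VS = (I (b, a) + J)%VS].
Proof.
case: hI => -[s [us Is ds fs]] hF hW hc; exists s; split.
- by split.
- split; first by move=> p; rewrite hF; exact: (sum_over_pred us Is (fun x => p <= x.1)).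
  by move=> k; rewrite hW; exact: (sum_over_pred us Is (fun x => x.1 + x.2 <= k)).
- by move=> p; exact: (sum_over_pred us Is (fun x => x.1 <= p)).
- move=> p; pose qs := undup [seq x.2 | x <- s].
  have uq : uniq qs by exact: undup_uniq.
  have Iq q : q \notin qs -> I (p, q) = 0%VS.
    move=> qn; apply: Is; apply: contra qn => pqs; rewrite mem_undup.
    by apply/mapP; exists (p, q).
  rewrite /Uspace (sum_over_isum uq Iq); apply/eqP; rewrite eqEsubv; apply/andP; split.
    by apply: (isum_sub (I := fun q => I (p, q))) => q _; apply: (sub_isum Is) => /=.
  apply: isum_sub => -[a b] /= /eqP ->.
  by apply: (sub_isum (I := fun q => I (p, q)) Iq); rewrite in_setE.
- move=> a b; rewrite -(sum_over_pred us Is (fun x => (x.1 < b) && (x.2 < a))).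
  have -> : [set x : int * int | (x.1 < b) && (x.2 < a)] = [set x | x.1 < b /\ x.2 < a].
    by apply/seteqP; split => x /= => [/andP|] [? ?] //; apply/andP.
  exact: hc.
Qed.

Lemma Uspace_direct : direct_decomposition Uspace.
Proof.
have [s [[us Is ds fs] _ _ hU _]] := deligne_data.
have := direct_fibres Is ds fs (fun x : int * int => x.1).
by congr direct_decomposition; apply/funext => p; rewrite hU.
Qed.

Lemma UspaceE p : Uspace p = (F p :&: Phi p)%VS.
Proof.
have [s [[us Is ds fs] [hF hW] hP hU _]] := deligne_data.
rewrite hF hP hU (isumI Is ds); apply: eq_isum => x /=.
by rewrite eq_le andbC.
Qed.

Lemma F_cap_Phi p : (F p :&: Phi (p + 1)%R = Uspace p + Uspace (p + 1)%R)%VS.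
Proof.
have [s [[us Is ds fs] [hF hW] hP hU _]] := deligne_data.
rewrite hF hP !hU (isumI Is ds) -(isumU Is); apply: eq_isum => x /=; lia.
Qed.

Lemma F_Phi_direct p : (F (p + 1)%R :&: Phi p = 0)%VS /\ (F (p + 1)%R + Phi p)%VS = fullv.
Proof.
have [s [[us Is ds fs] [hF hW] hP _ _]] := deligne_data.
rewrite hF hP -(isumU Is) -(isumT fs); split; last by apply: eq_isum => x /=; lia.
apply: (isum_disjoint Is ds) => x /=; lia.
Qed.

Lemma F_add_Phi p : (F p + Phi p)%VS = fullv.
Proof.
have [s [[us Is ds fs] [hF _] hP hU _]] := deligne_data.
rewrite hF hP -(isumU Is) -(isumT fs); apply: eq_isum => x /=; lia.
Qed.

Lemma Ucompl_direct p : (Uspace p :&: Ucompl p = 0)%VS /\ (Uspace p + Ucompl p)%VS = fullv.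
Proof.
have [s [[us Is ds fs] [hF hW] hP hU _]] := deligne_data.
rewrite /Ucompl hU hF hP -!(isumU Is) -(isumT fs); split; last first.
  by apply: eq_isum => x /=; lia.
apply: (isum_disjoint Is ds) => x /=; lia.
Qed.

Lemma Uspace_sub_Ucompl p q : q != p -> (Uspace q <= Ucompl p)%VS.
Proof.
move=> qp; have [s [[us Is ds fs] [hF _] hP hU _]] := deligne_data.
rewrite /Ucompl hU hF hP -(isumU Is); apply: (isumS Is) => x /=; lia.
Qed.

Lemma PhiS p q : p <= q -> (Phi p <= Phi q)%VS.
Proof.
move=> pq; have [s [[us Is ds fs] _ hP _ _]] := deligne_data.
rewrite !hP; apply: (isumS Is) => x /=; lia.
Qed.

(** F^r \cap W_k is the sum of the I^(a,b) with a >= r and a + b <= k, whose conjugates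
    lie in I^(b,a) plus summands with first index < b, and b <= k - r. *)
Lemma conj_FW_Phi r k u : u \in F r -> u \in complexify R (W k) -> cmx u \in Phi (k - r).
Proof.
have [s [[us Is ds fs] [hF hW] hP _ hc]] := deligne_data.
rewrite hF hW => uF uW.
pose A := isum I s (fun x => r <= x.1); pose B := isum I s (fun x => x.1 + x.2 <= k).
have : u \in (A :&: B)%VS by rewrite memv_cap uF.
rewrite (isumI Is ds) => uI.
apply: (isum_memP uI (Z := fun u => cmx u \in Phi (k - r))).
- by rewrite /cmx map_mx0 mem0v.
- by move=> x y hx hy; rewrite /cmx map_mxD memvD.
move=> -[a b] x /= /andP[ra abk] xI.
have : cmx x \in (I (b, a) + isum I s (fun x => (x.1 < b) && (x.2 < a)))%VS.
  by rewrite -hc; apply: (subvP (addvSl _ _)); rewrite mem_conj_space cmxK.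
apply: subvP; rewrite hP subv_add; apply/andP; split.
  by apply: (sub_isum Is) => /=; lia.
by apply: (isumS Is) => t /andP[/= tb ta]; lia.
Qed.

(** Phi_p is spanned by the conjugates of the F^r \cap W_k with k - r <= p: a vector of
    I^(a,b) is the conjugate of a vector of I^(b,a), which lies in
    F^b \cap W_(a+b), up to summands with smaller first index. *)
Lemma Phi_ind p (Z : 'rV[C]_n -> Prop) : Z 0 ->
  (forall x y, Z x -> Z y -> Z (x + y)) ->
  (forall r k u, k - r <= p -> u \in F r -> u \in complexify R (W k) -> Z (cmx u)) ->
  forall u, u \in Phi p -> Z u.
Proof.
move=> Z0 ZD ZFW.
have [s [[us Is ds fs] [hF hW] hP _ hc]] := deligne_data.
(* The induction on the first index starts below all the indices that occur. *)
have [lo los] : exists lo : int, forall x, x \in s -> lo <= x.1.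
  elim: (s) => [|x s' [lo IH]]; first by exists 0.
  exists (Num.min lo x.1) => y; rewrite inE ge_min => /orP[/eqP ->|/IH ->] //.
  by rewrite lexx orbT.
suff H (N : nat) : forall a b, a <= p -> a < lo + N%:Z -> forall u, u \in I (a, b) -> Z u.
  move=> u; rewrite hP => uI; apply: (isum_memP uI Z0 ZD) => -[a b] x /= ap xI.
  by apply: (H `|a - lo|.+1%N a b) => //; lia.
elim: N => [|N IH] a b ap aN u uI.
  suff E : I (a, b) = 0%VS by move: uI; rewrite E memv0 => /eqP ->.
  by apply: Is; apply/negP => /los /=; lia.
have : u \in (conj_space (I (b, a)) + isum I s (fun x => (x.1 < a) && (x.2 < b)))%VS.
  by rewrite hc; apply: (subvP (addvSl _ _)).
move=> /memv_addP[y yI [z zJ ->]]; apply: (ZD _ _).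
  rewrite -(cmxK y); rewrite mem_conj_space in yI; apply: (ZFW b (a + b)).
  - by lia.
  - by rewrite hF; apply: subvP yI; apply: (sub_isum Is).
  - by rewrite hW; apply: subvP yI; apply: (sub_isum Is) => /=; lia.
apply: (isum_memP zJ Z0 ZD) => -[c d] x /= cd xI; apply: (IH c d) xI; lia.
Qed.

End DeligneBigrading.

(** * Families of subspaces of a fixed space *)

Section LocalFamilies.
Variables (R : realType) (S : topologicalType) (M : complex_manifold R S).
Local Notation C := (Cx R).
Implicit Types (s : S) (c : chart M).

(** The values on v of the (1,0)-part and of the (0,1)-part of the differential; i v
    is the complex structure applied to v. *)
Definition d10 m n c (v : 'rV[C]_(cdim c)) (A : S -> 'M[C]_(m, n)) s : 'M[C]_(m, n) :=
  2^-1 *: (dmx v A s - 'i *: dmx ('i *: v) A s).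
Definition d01 m n c (v : 'rV[C]_(cdim c)) (A : S -> 'M[C]_(m, n)) s : 'M[C]_(m, n) :=
  2^-1 *: (dmx v A s + 'i *: dmx ('i *: v) A s).

Lemma d10_d01 m n c v (A : S -> 'M[C]_(m, n)) s :
  @dmx _ _ M _ _ c v A s = d01 v A s + d10 v A s.
Proof.
rewrite /d10 /d01 -scalerDr addrACA addrN addr0 -mulr2n.
by rewrite -scalerMnr scalerMnl -mulr_natr mulVf ?scale1r // pnatr_eq0.
Qed.

Lemma d10_eq m n c v s (A B : S -> 'M[C]_(m, n)) :
  cdom c s -> smooth_mx M s A -> (\forall t \near s, A t = B t) ->
  @d10 _ _ c v A s = d10 v B s.
Proof. by move=> cs hA AB; rewrite /d10 !(dmx_eq _ cs hA AB). Qed.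

Lemma d01_eq m n c v s (A B : S -> 'M[C]_(m, n)) :
  cdom c s -> smooth_mx M s A -> (\forall t \near s, A t = B t) ->
  @d01 _ _ c v A s = d01 v B s.
Proof. by move=> cs hA AB; rewrite /d01 !(dmx_eq _ cs hA AB). Qed.

Lemma d10D m n c v s (A B : S -> 'M[C]_(m, n)) :
  cdom c s -> smooth_mx M s A -> smooth_mx M s B ->
  @d10 _ _ c v (fun t => A t + B t) s = d10 v A s + d10 v B s.
Proof.
by move=> cs hA hB; rewrite /d10 !dmxD // (scalerDr 'i) opprD -[RHS]scalerDr addrACA.
Qed.

Lemma d01D m n c v s (A B : S -> 'M[C]_(m, n)) :
  cdom c s -> smooth_mx M s A -> smooth_mx M s B ->
  @d01 _ _ c v (fun t => A t + B t) s = d01 v A s + d01 v B s.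
Proof.
by move=> cs hA hB; rewrite /d01 !dmxD // (scalerDr 'i) -[RHS]scalerDr addrACA.
Qed.

Lemma d10M m n p c v s (A : S -> 'M[C]_(m, n)) (B : S -> 'M[C]_(n, p)) :
  cdom c s -> smooth_mx M s A -> smooth_mx M s B ->
  @d10 _ _ c v (fun t => A t *m B t) s = d10 v A s *m B s + A s *m d10 v B s.
Proof.
move=> cs hA hB; rewrite /d10 !dmxM // (scalerDr 'i) opprD addrACA scalerDr.
by rewrite -!scalemxAl -!scalemxAr mulmxBl mulmxBr -!scalemxAl -!scalemxAr.
Qed.

Lemma d01M m n p c v s (A : S -> 'M[C]_(m, n)) (B : S -> 'M[C]_(n, p)) :
  cdom c s -> smooth_mx M s A -> smooth_mx M s B ->
  @d01 _ _ c v (fun t => A t *m B t) s = d01 v A s *m B s + A s *m d01 v B s.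
Proof.
move=> cs hA hB; rewrite /d01 !dmxM // (scalerDr 'i) addrACA scalerDr.
by rewrite -!scalemxAl -!scalemxAr mulmxDl mulmxDr -!scalemxAl -!scalemxAr.
Qed.

(** Conjugation exchanges the two types. *)
Lemma d10_conj n c v s (A : S -> 'rV[C]_n) : cdom c s -> smooth_mx M s A ->
  @d10 _ _ c v (fun t => cmx (A t)) s = cmx (d01 v A s).
Proof.
move=> cs hA; rewrite /d10 /d01 !(dmx_conj _ cs hA); apply/matrixP => i j.
by rewrite !mxE rmorphM rmorphD rmorphM fmorphV rmorph_nat /= conjCi mulNr.
Qed.

Lemma d01_conj n c v s (A : S -> 'rV[C]_n) : cdom c s -> smooth_mx M s A ->
  @d01 _ _ c v (fun t => cmx (A t)) s = cmx (d10 v A s).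
Proof.
move=> cs hA; rewrite /d10 /d01 !(dmx_conj _ cs hA); apply/matrixP => i j.
by rewrite !mxE rmorphM rmorphB rmorphM fmorphV rmorph_nat /= conjCi mulNr opprK.
Qed.

Variable n : nat.
Implicit Types (B : S -> {vspace 'rV[C]_n}) (X Y : {vspace 'rV[C]_n}).

Definition frame_of s m (A : S -> 'M[C]_(m, n)) B :=
  [/\ smooth_mx M s A, row_free (A s) &
      \forall t \near s, forall u, (u \in B t) = (u <= A t)%MS].

(** The constraints X and Y on the types of the derivatives are recorded together
    with the extension of u, because the resulting property is stable under
    addition: Phi_p can then be treated one generator at a time. *)
Definition extends s B X Y u := exists e : S -> 'rV[C]_n,
  [/\ smooth_mx M s e, e s = u, \forall t \near s, e t \in B t &
      forall c v, cdom c s -> @d10 _ _ c v e s \in X /\ @d01 _ _ c v e s \in Y].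

Definition spanned s B X Y := forall u, u \in B s -> extends s B X Y u.

Lemma extendsD s B X Y u v : extends s B X Y u -> extends s B X Y v ->
  extends s B X Y (u + v).
Proof.
move=> [e [he es eB de]] [f [hf fs fB df]]; exists (fun t => e t + f t); split.
- exact: smooth_mxD.
- by rewrite es fs.
- by apply: filterS2 eB fB => t; exact: memvD.
- move=> c w cs; have [e1 e2] := de c w cs; have [f1 f2] := df c w cs.
  rewrite (d10D w cs he hf) (d01D w cs he hf).
  by split; [exact: (memvD e1 f1)|exact: (memvD e2 f2)].
Qed.

Lemma d10_cst m p c v s (A : 'M[C]_(m, p)) : @d10 _ _ c v (fun=> A) s = 0.
Proof. by rewrite /d10 !dmx_cst scaler0 subr0 scaler0. Qed.
Lemma d01_cst m p c v s (A : 'M[C]_(m, p)) : @d01 _ _ c v (fun=> A) s = 0.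
Proof. by rewrite /d01 !dmx_cst scaler0 addr0 scaler0. Qed.

Lemma extends0 s B X Y : extends s B X Y 0.
Proof.
exists (fun=> 0); split => //; first exact: smooth_mx_cst.
  by near=> t; exact: mem0v.
by move=> c v cs; rewrite d10_cst d01_cst !mem0v.
Unshelve. all: by end_near. Qed.

Lemma extends_sub s B B' X Y u :
  (\forall t \near s, (B t <= B' t)%VS) -> extends s B X Y u ->
  extends s B' fullv fullv u.
Proof.
move=> BB' [e [he es eB _]]; exists e; split => //.
  by apply: filterS2 BB' eB => t /subvP; exact.
by move=> c v cs; rewrite !memvf.
Qed.

Lemma frame_dim s m (A : S -> 'M[C]_(m, n)) B : frame_of s A B ->
  \forall t \near s, \dim (B t) = m.
Proof.
move=> [hA fA AB]; apply: filterS2 AB (row_free_near hA fA) => t Bt.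
by rewrite (dim_rank Bt) => /eqP.
Qed.

Lemma frame_dim_near s m (A : S -> 'M[C]_(m, n)) B : frame_of s A B ->
  \forall t \near s, \dim (B t) = \dim (B s).
Proof.
move=> /frame_dim d; have := nbhs_singleton d.
by move=> ds; apply: filterS d => t ->.
Qed.

Lemma frame_direct s m1 m2 (A1 : S -> 'M[C]_(m1, n)) (A2 : S -> 'M[C]_(m2, n)) B1 B2 :
  frame_of s A1 B1 -> frame_of s A2 B2 -> (B1 s :&: B2 s = 0)%VS ->
  row_free (col_mx (A1 s) (A2 s)).
Proof.
move=> [_ f1 /nbhs_singleton E1] [_ f2 /nbhs_singleton E2] B0.
rewrite /row_free (rank_col_mx E1 E2) (dimv_disjoint_sum B0).
by rewrite (dim_rank E1) (dim_rank E2) (eqP f1) (eqP f2).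
Qed.

Lemma row_dmx m c v s (A : S -> 'M[C]_(m, n)) i :
  row i (@dmx _ _ M _ _ c v A s) = dmx v (fun t => row i (A t)) s.
Proof.
apply/rowP => j; rewrite !mxE.
have -> // : (fun t => row i (A t) 0 j) = (fun t => A t i j).
by apply/funext => t; rewrite mxE.
Qed.

Lemma row_d10 m c v s (A : S -> 'M[C]_(m, n)) i :
  row i (@d10 _ _ c v A s) = d10 v (fun t => row i (A t)) s.
Proof. by rewrite /d10 -!row_dmx; apply/rowP => j; rewrite !mxE. Qed.

Lemma row_d01 m c v s (A : S -> 'M[C]_(m, n)) i :
  row i (@d01 _ _ c v A s) = d01 v (fun t => row i (A t)) s.
Proof. by rewrite /d01 -!row_dmx; apply/rowP => j; rewrite !mxE. Qed.

(** Sections extending a basis of B s stay independent near s, and by the constancy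
    of the dimension they keep spanning B. *)
Lemma spanned_frame s B X Y : spanned s B X Y ->
  (\forall t \near s, \dim (B t) = \dim (B s)) ->
  exists A : S -> 'M[C]_(\dim (B s), n), frame_of s A B /\
    forall c v, cdom c s -> forall x : 'rV_(\dim (B s)),
      x *m @d10 _ _ c v A s \in X /\ x *m @d01 _ _ c v A s \in Y.
Proof.
move=> sB dB; set d := \dim (B s).
have H (i : 'I_d) : extends s B X Y (vbasis (B s))`_i.
  by apply: sB; apply: vbasis_mem; apply: mem_nth; rewrite size_tuple.
have [e eP] := choice H.
pose A t : 'M[C]_(d, n) := \matrix_(i, j) e i t 0 j.
have rA t i : row i (A t) = e i t by apply/rowP => j; rewrite !mxE.
have hA : smooth_mx M s A.
  by move=> i j; under eq_fun do rewrite mxE; have [h _ _ _] := eP i; exact: h.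
have fA : row_free (A s).
  apply: (row_free_tuple (basis_free (vbasisP (B s)))) => i.
  by rewrite rA; have [_ -> _ _] := eP i.
exists A; split.
  split => //.
  have eB : \forall t \near s, forall i, e i t \in B t.
    by apply: filter_forall => i; have [_ _ h _] := eP i.
  apply: filterS3 eB (row_free_near hA fA) dB => t et ft dt.
  by apply: row_free_memv => // i; rewrite rA.
move=> c v cs x; split; apply: memv_mulmx => i; rewrite ?row_d10 ?row_d01.
  rewrite (_ : (fun t => _) = e i); last by apply/funext => t; rewrite rA.
  by have [_ _ _ h] := eP i; have [] := h c v cs.
rewrite (_ : (fun t => _) = e i); last by apply/funext => t; rewrite rA.
by have [_ _ _ h] := eP i; have [] := h c v cs.
Qed.

(** By the Leibniz rule, the derivatives of an arbitrary section of B are controlled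
    by those of the members of one frame, up to B itself. *)
Lemma section_deriv s B X Y (sigma : S -> 'rV[C]_n) : spanned s B X Y ->
  (\forall t \near s, \dim (B t) = \dim (B s)) ->
  (B s <= X)%VS -> (B s <= Y)%VS ->
  smooth_mx M s sigma -> (\forall t \near s, sigma t \in B t) ->
  forall c v, cdom c s -> @d10 _ _ c v sigma s \in X /\ @d01 _ _ c v sigma s \in Y.
Proof.
move=> sB dB BX BY hs sigB c v cs.
have [A [[hA fA AB] dA]] := spanned_frame sB dB.
have [|g hg gE] := frame_coef hA fA hs.
  by apply: filterS2 sigB AB => t st <-.
have ABs := nbhs_singleton AB.
rewrite (d10_eq _ cs hs gE) (d01_eq _ cs hs gE) d10M // d01M //.
have [d1 d2] := dA c v cs (g s).
split; apply: memvD => //; [apply: (subvP BX)|apply: (subvP BY)];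
  by rewrite ABs submxMl.
Qed.

(** The rank of the stacked frames is the dimension of B1 + B2, which is locally
    constant together with those of B1, B2 and their intersection. *)
Lemma extends_cap s B1 B2 m1 m2 (A1 : S -> 'M[C]_(m1, n)) (A2 : S -> 'M[C]_(m2, n)) :
  frame_of s A1 B1 -> frame_of s A2 B2 ->
  (\forall t \near s, \dim (B1 t :&: B2 t) = \dim (B1 s :&: B2 s)) ->
  forall u, u \in (B1 s :&: B2 s)%VS -> exists e : S -> 'rV[C]_n,
    [/\ smooth_mx M s e, e s = u & \forall t \near s, e t \in (B1 t :&: B2 t)%VS].
Proof.
move=> f1 f2 dB u; rewrite memv_cap => /andP[u1 u2].
have [h1 _ A1B] := f1; have [h2 _ A2B] := f2.
rewrite (nbhs_singleton A1B) in u1; rewrite (nbhs_singleton A2B) in u2.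
have rA : \forall t \near s, \rank (col_mx (A1 t) (A2 t)) = \rank (col_mx (A1 s) (A2 s)).
  near=> t.
  have E1 : forall u, (u \in B1 t) = (u <= A1 t)%MS by near: t.
  have E2 : forall u, (u \in B2 t) = (u <= A2 t)%MS by near: t.
  rewrite (rank_col_mx E1 E2) (rank_col_mx (nbhs_singleton A1B) (nbhs_singleton A2B)).
  apply/eqP; rewrite -(eqn_add2r (\dim (B1 t :&: B2 t))) dimv_sum_cap.
  have -> : \dim (B1 t :&: B2 t) = \dim (B1 s :&: B2 s) by near: t.
  rewrite dimv_sum_cap.
  have -> : \dim (B1 t) = \dim (B1 s) by near: t; exact: (frame_dim_near f1).
  by have -> : \dim (B2 t) = \dim (B2 s) by near: t; exact: (frame_dim_near f2).
have [e [he es eB]] := smooth_capmx h1 h2 rA u1 u2.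
exists e; split => //; apply: filterS3 A1B A2B eB => t E1 E2 [et1 et2].
by rewrite memv_cap E1 E2 et1.
Unshelve. all: by end_near. Qed.

End LocalFamilies.

(** * Local trivializations *)

Section Transport.
Variables (R : realType) (S : topologicalType) (M : complex_manifold R S).
Variable V : local_system S.
Local Notation C := (Cx R).
Implicit Types (s : S) (c : chart M) (B : Cfamily R V) (sigma : bsection R V).

Definition transport s0 t : 'M[C]_(lrank V t, lrank V s0) := map_mx ratr (ltr V s0 t).

Lemma transport_refl s : transport s s = 1%:M.
Proof. by rewrite /transport ltr_refl map_mx1. Qed.

Lemma near_lnbhd s0 s : lnbhd V s0 s -> \forall t \near s, lnbhd V s0 t.
Proof. by move=> h; apply: open_nbhs_nbhs; split => //; exact: lnbhd_open. Qed.

Lemma near_lnbhd_refl s : \forall t \near s, lnbhd V s t.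
Proof. by apply: near_lnbhd; exact: lnbhd_refl. Qed.

Lemma transport_inv s0 t : lnbhd V s0 t -> exists N : 'M[C]_(lrank V s0, lrank V t),
  transport s0 t *m N = 1%:M /\ N *m transport s0 t = 1%:M.
Proof.
move=> /ltr_inv[N [h1 h2]]; exists (map_mx ratr N).
by rewrite /transport -!map_mxM h1 h2 !map_mx1.
Qed.

Lemma transport_inj s0 t m : lnbhd V s0 t ->
  injective (fun u : 'M[C]_(m, lrank V t) => u *m transport s0 t).
Proof.
move=> /transport_inv[N [TN _]]; apply: (can_inj (g := mulmx^~ N)) => u.
by rewrite -mulmxA TN mulmx1.
Qed.

(** The transition matrix is locally constant, hence equal to its value at s, where
    the trivialization around s is the identity. *)
Lemma transport_change s0 s : lnbhd V s0 s ->
  \forall t \near s, transport s0 t = transport s t *m transport s0 s.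
Proof.
move=> h; have [A AE] := ltr_locally_constant (lnbhd_refl V s) h.
have As := nbhs_singleton AE; rewrite /= ltr_refl mul1mx in As.
by apply: filterS AE => t E; rewrite /transport As E map_mxM.
Qed.

(** Families of subspaces are compared with constant ones after being moved to the
    fibre at s0. *)
Definition loc s0 B (t : S) : {vspace 'rV[C]_(lrank V s0)} :=
  (linfun (mulmxr (transport s0 t)) @: B t)%VS.

Lemma mem_locP s0 B t u :
  reflect (exists2 w, w \in B t & u = w *m transport s0 t) (u \in loc s0 B t).
Proof.
by apply: (iffP memv_imgP) => -[w wB ->]; exists w => //; rewrite lfunE.
Qed.

Lemma mem_loc_transport s0 B t w : lnbhd V s0 t ->
  (w *m transport s0 t \in loc s0 B t) = (w \in B t).
Proof.
move=> h; apply/mem_locP/idP => [[w' w'B /(transport_inj h) ->]//|wB].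
by exists w.
Qed.

Lemma loc_refl s B : loc s B s = B s.
Proof.
apply/vspaceP => u; rewrite -{1}(mulmx1 u) -(transport_refl s).
by rewrite mem_loc_transport //; exact: lnbhd_refl.
Qed.

Lemma dim_transport_img s0 t (U : {vspace 'rV[C]_(lrank V t)}) : lnbhd V s0 t ->
  \dim (linfun (mulmxr (transport s0 t)) @: U) = \dim U.
Proof.
move=> h; apply: limg_dim_eq; apply/eqP; rewrite -subv0; apply/subvP => u.
rewrite memv_cap memv_ker lfunE /= memv0 => /andP[_ /eqP E].
by apply/eqP; apply: (transport_inj h); rewrite E mul0mx.
Qed.

Lemma dim_loc s0 B t : lnbhd V s0 t -> \dim (loc s0 B t) = \dim (B t).
Proof. exact: dim_transport_img. Qed.

Lemma locS s0 B B' t : (B t <= B' t)%VS -> (loc s0 B t <= loc s0 B' t)%VS.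
Proof. exact: limgS. Qed.

Lemma loc_cap s0 B B' t : lnbhd V s0 t ->
  loc s0 (fun s => B s :&: B' s)%VS t = (loc s0 B t :&: loc s0 B' t)%VS.
Proof.
move=> h; apply/vspaceP => u; have [N [_ NT]] := transport_inv h.
have -> : u = (u *m N) *m transport s0 t by rewrite -mulmxA NT mulmx1.
by rewrite memv_cap !mem_loc_transport // memv_cap.
Qed.

Lemma cmx_transport s0 t m (w : 'M[C]_(m, lrank V t)) :
  cmx (w *m transport s0 t) = cmx w *m transport s0 t.
Proof.
rewrite /cmx map_mxM; congr (_ *m _).
by apply/matrixP => i j; rewrite !mxE fmorph_rat.
Qed.

(** The rational statement says that the images of W_t are W_s0; the
    complexifications have the same dimensions. *)
Lemma loc_flat (W : Qfamily V) s0 : flat_family W ->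
  \forall t \near s0, loc s0 (fun s => complexify R (W s)) t = complexify R (W s0).
Proof.
move=> /(_ s0) fW; apply: filterS2 fW (near_lnbhd_refl s0) => t Wt h.
apply/eqP; rewrite eqEdim; apply/andP; split.
  rewrite /loc /complexify /ext_space limg_span; apply/span_subvP => u.
  move=> /mapP[_ /mapP[w wW ->] ->]; rewrite lfunE /= /transport -map_mxM.
  rewrite -/(complexify R (W s0)) /complexify.
  rewrite (@mem_ext_map _ _ (ratr : {rmorphism rat -> C})).
  rewrite -Wt; apply/memv_imgP; exists w; last by rewrite lfunE.
  exact: vbasis_mem.
rewrite dim_loc // /complexify !(@dim_ext_space _ _ (ratr : {rmorphism rat -> C})).
by rewrite -Wt -[leqRHS](limg_ker_dim (linfun (mulmxr (ltr V s0 t)))) leq_addl.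
Qed.

(** * Sections in local trivializations *)

Definition triv s0 sigma t : 'rV[C]_(lrank V s0) := sigma t *m transport s0 t.

Lemma triv_change s0 s sigma : lnbhd V s0 s ->
  \forall t \near s, triv s sigma t *m transport s0 s = triv s0 sigma t.
Proof.
move=> /transport_change; apply: filterS => t E.
by rewrite /triv E mulmxA.
Qed.

Lemma smooth_triv s0 s sigma : lnbhd V s0 s -> smooth_mx M s (triv s sigma) ->
  smooth_mx M s (triv s0 sigma).
Proof.
move=> h hs; apply: smooth_mx_eq (triv_change sigma h) _.
by apply: smooth_mxM => //; exact: smooth_mx_cst.
Qed.

Lemma smooth_sectionP O sigma : open O ->
  smooth_section M O sigma <-> forall s, O s -> smooth_mx M s (triv s sigma).
Proof.
move=> oO; split => [hs s Os i j|hs c s0 j k].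
  rewrite (ord1 i); apply: (@smooth_fun_at _ _ M (O `&` lnbhd V s)).
  - by apply: openI => //; exact: lnbhd_open.
  - by split => //; exact: lnbhd_refl.
  - by move=> c; rewrite setIAC; exact: hs.
rewrite setIAC.
have : smooth_fun M (O `&` lnbhd V s0) (fun t => triv s0 sigma t 0 j).
  by apply: smooth_fun_local => t [Ot h]; apply: smooth_triv => //; exact: hs.
by move=> /(_ c k).
Qed.

Lemma nablaE sigma c s (v : 'rV[C]_(cdim c)) : nabla sigma s v = dmx v (triv s sigma) s.
Proof. by apply/rowP => j; rewrite !mxE. Qed.

(** nabla at s is computed in the trivialization around s; the trivialization around
    s0 differs from it by a constant matrix, which has zero derivative. *)
Lemma nabla_transport sigma c s0 s (v : 'rV[C]_(cdim c)) : cdom c s -> lnbhd V s0 s ->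
  smooth_mx M s (triv s sigma) ->
  nabla sigma s v *m transport s0 s = dmx v (triv s0 sigma) s.
Proof.
move=> cs h hs; have hT := smooth_mx_cst M s (transport s0 s).
rewrite nablaE -(dmx_eq v cs (smooth_mxM hs hT) (triv_change sigma h)).
by rewrite dmxM // dmx_cst mulmx0 addr0.
Qed.

(** The local section with a prescribed expression in the trivialization around
    s0. *)
Definition section_of s0 (f : S -> 'rV[C]_(lrank V s0)) : bsection R V :=
  fun t => f t *m pinvmx (transport s0 t).

Lemma triv_section_of s0 f t : lnbhd V s0 t -> triv s0 (@section_of s0 f) t = f t.
Proof.
move=> /transport_inv[N [_ NT]]; rewrite /triv /section_of -mulmxA mulVpmx ?mulmx1 //.
by apply/row_fullP; exists N.
Qed.

Lemma smooth_section_of s0 f s : lnbhd V s0 s -> smooth_mx M s f ->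
  smooth_mx M s (triv s (@section_of s0 f)).
Proof.
move=> h hf; have [N [TN _]] := transport_inv h.
have hN := smooth_mx_cst M s N.
apply: smooth_mx_eq (smooth_mxM hf hN).
apply: filterS2 (triv_change (section_of f) h) (near_lnbhd h) => t E ht.
by rewrite -(triv_section_of f ht) -E -mulmxA TN mulmx1.
Qed.

(** * Frames of subbundles *)

Lemma frame_of_sections s0 (B : Cfamily R V) (N : set S) m (e : 'I_m -> bsection R V) :
  open N -> N s0 -> (forall i, smooth_section M N (e i)) ->
  (forall s, N s -> basis_of (B s) [seq e i s | i <- enum 'I_m]) ->
  frame_of M s0 (fun t => \matrix_(i, j) triv s0 (e i) t 0 j) (loc s0 B).
Proof.
move=> oN Ns he eB; pose E t : 'M[C]_(m, lrank V t) := \matrix_(i, j) e i t 0 j.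
have rE t i : row i (E t) = e i t by apply/rowP => j; rewrite !mxE.
have EB t u : N t -> (u \in B t) = (u <= E t)%MS.
  move=> /eB eBt; rewrite -(span_basis eBt) memv_spanE.
  apply/idP/idP => h; apply: submx_trans h _; apply/row_subP => i.
    rewrite row_seq_mx; have /mapP[k _ ->] := mem_nth 0 (ltn_ord i).
    by rewrite -rE row_sub.
  rewrite rE -memv_spanE; apply: memv_span; apply: map_f; exact: mem_enum.
have fE t : N t -> row_free (E t).
  move=> Nt; rewrite /row_free -(dim_rank (fun u => EB t u Nt)).
  by rewrite -(span_basis (eB t Nt)) (eqP (basis_free (eB t Nt))) size_map size_enum_ord.
have AE t : (\matrix_(i, j) triv s0 (e i) t 0 j : 'M[C]_(m, lrank V s0)) =
    E t *m transport s0 t.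
  by apply/row_matrixP => i; rewrite row_mul rE; apply/rowP => j; rewrite !mxE.
split.
- move=> i j; under eq_fun do rewrite mxE.
  by have /(smooth_sectionP _ oN)/(_ s0 Ns) h := he i; exact: h.
- by rewrite AE transport_refl mulmx1; exact: fE.
- have nN : \forall t \near s0, N t by exact: open_nbhs_nbhs.
  apply: filterS2 nN (near_lnbhd_refl s0) => t Nt h u.
  have [N' [_ NT]] := transport_inv h.
  have -> : u = (u *m N') *m transport s0 t by rewrite -mulmxA NT mulmx1.
  rewrite mem_loc_transport // EB // AE.
  apply/idP/idP => [|/submxP[x]]; first exact: submxMr.
  by rewrite mulmxA => /(transport_inj h) ->; exact: submxMl.
Qed.

Lemma smooth_subbundle_frames (B : Cfamily R V) :
  (forall s0, exists m (A : S -> 'M[C]_(m, lrank V s0)), frame_of M s0 A (loc s0 B)) ->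
  smooth_subbundle M B.
Proof.
move=> fB s0; have [m [A [hA fA AB]]] := fB s0.
pose P t := [/\ lnbhd V s0 t, smooth_mx M t A, row_free (A t) &
  forall u, (u \in loc s0 B t) = (u <= A t)%MS].
have nP : nbhs s0 [set t | P t].
  near=> t; split; near: t => //.
  - exact: near_lnbhd_refl.
  - exact: smooth_mx_near.
  - exact: row_free_near.
have /nbhs_interior/nbhs_singleton nPi := nP.
have iP t : interior [set t | P t] t -> P t by exact: interior_subset.
have rs (t : S) : lnbhd V s0 t -> row_free (transport s0 t).
  by move=> /transport_inv[N [TN _]]; apply/row_freeP; exists N.
exists (interior [set t | P t]), m, (fun i => section_of (s0 := s0) (fun t => row i (A t))).
split => //; first exact: open_interior.
  move=> i; apply/smooth_sectionP; first exact: open_interior.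
  move=> t /iP [h hAt _ _]; apply: (smooth_section_of h) => k l.
  by under eq_fun do rewrite mxE; exact: hAt.
move=> t /iP [h _ fAt ABt]; rewrite basisEdim size_map size_enum_ord.
apply/andP; split; last by rewrite -(dim_loc B h) (dim_rank ABt) (eqP fAt).
apply/subvP => w wB.
have : w *m transport s0 t \in loc s0 B t by rewrite mem_loc_transport.
rewrite ABt => /submxP[x E].
have -> : w = x *m A t *m pinvmx (transport s0 t).
  by rewrite -E -mulmxA mulmxVp ?mulmx1 //; exact: rs.
rewrite -mulmxA mulmx_sum_row; apply: memv_suml => i _; apply: memvZ; apply: memv_span.
by apply/mapP; exists i; [exact: mem_enum|rewrite /section_of -row_mul].
Unshelve. all: by end_near. Qed.

Lemma smooth_projection (B1 B2 : Cfamily R V) s m1 m2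
    (A1 : S -> 'M[C]_(m1, lrank V s)) (A2 : S -> 'M[C]_(m2, lrank V s))
    (sigma : bsection R V) :
  frame_of M s A1 (loc s B1) -> frame_of M s A2 (loc s B2) ->
  (forall t, (B1 t :&: B2 t = 0)%VS) -> (forall t, (B1 t + B2 t)%VS = fullv) ->
  smooth_mx M s (triv s sigma) ->
  smooth_mx M s (triv s (fun t => daddv_pi (B1 t) (B2 t) (sigma t))).
Proof.
move=> f1 f2 B0 BT hs; have [h1 _ E1] := f1; have [h2 _ E2] := f2.
have ff : row_free (col_mx (A1 s) (A2 s)).
  by apply: (frame_direct f1 f2); rewrite !loc_refl.
apply: (smooth_proj h1 h2 ff (v := triv s (fun t => daddv_pi (B2 t) (B1 t) (sigma t)))).
- apply: filterS2 E1 (near_lnbhd_refl s) => t E h.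
  by rewrite -E /triv mem_loc_transport // memv_pi.
- apply: filterS2 E2 (near_lnbhd_refl s) => t E h.
  by rewrite -E /triv mem_loc_transport // memv_pi.
rewrite (_ : (fun t => _) = triv s sigma) //; apply/funext => t.
by rewrite /triv -mulmxDl (daddv_pi_add (B0 t)) ?BT ?memvf.
Qed.

End Transport.

Section Filtrations.
Variables (R : realType) (S : topologicalType) (M : complex_manifold R S).
Variable (V : gp_vmhs M).
Local Notation C := (Cx R).
Local Notation ls := (vls V).
Variable I : forall s, int * int -> {vspace 'rV[C]_(lrank ls s)}.
Hypothesis hI : forall s,
  deligne_bigrading (fun p => hfil V p s) (fun k => wfil V k s) (I s).
Implicit Types (s t : S) (c : chart M) (p k : int) (B : Cfamily R ls).

Definition cW k : Cfamily R ls := fun s => complexify R (wfil V k s).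
Definition PhiF p : Cfamily R ls := fun s => Phi (I s) p.
Definition UF p : Cfamily R ls := fun s => Uspace (I s) p.
Definition UcF p : Cfamily R ls := fun s => Ucompl (hfil V ^~ s) (I s) p.

(** * Local constancy of the ranks *)

Lemma near_lrank s0 : \forall t \near s0, lrank ls t = lrank ls s0.
Proof.
apply: filterS (near_lnbhd_refl ls s0) => t /(transport_inv R)[N [h1 h2]].
by apply/eqP; rewrite eqn_leq (mulmx1_min h1) (mulmx1_min h2).
Qed.

Lemma subbundle_dim regular (B : Cfamily R ls) s0 : @subbundle R S ls regular B ->
  \forall t \near s0, \dim (B t) = \dim (B s0).
Proof.
move=> /(_ s0)[N [m [e [oN Ns _ eB]]]].
have dB t : N t -> \dim (B t) = m.
  move=> Nt; rewrite -(span_basis (eB t Nt)) (eqP (basis_free (eB t Nt))).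
  by rewrite size_map size_enum_ord.
have : nbhs s0 N by exact: open_nbhs_nbhs.
by apply: filterS => t Nt; rewrite !dB.
Qed.

Lemma dim_near_loc s0 B : (\forall t \near s0, \dim (B t) = \dim (B s0)) ->
  \forall t \near s0, \dim (loc s0 B t) = \dim (loc s0 B s0).
Proof.
move=> dB; apply: filterS2 dB (near_lnbhd_refl ls s0) => t d h.
by rewrite !dim_loc //; exact: lnbhd_refl.
Qed.

Lemma dim_cW k s0 : \forall t \near s0, \dim (cW k t) = \dim (cW k s0).
Proof.
apply: filterS2 (loc_flat R s0 (@wfil_flat _ _ _ V k)) (near_lnbhd_refl ls s0) => t E h.
by rewrite -(dim_loc (cW k) h) /cW E.
Qed.

Lemma wfilS j k s : j <= k -> (wfil V j s <= wfil V k s)%VS.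
Proof.
move=> jk; have -> : k = j + `|k - j|%N%:Z by lia.
elim: `|k - j|%N => [|N IH]; first by rewrite addr0.
apply: subv_trans IH _; have -> : j + N.+1%:Z = j + N%:Z + 1 by lia.
exact: wfil_increasing.
Qed.

(** The graded pieces of F are bundles, and G^p_k, the preimage of F^p Gr_k, satisfies
    dim G^p_k + dim (F^p \cap W_(k-1)) = dim (F^p \cap W_k) + dim W_(k-1); so
    the claim follows by induction on k, starting where W vanishes. *)
Lemma dim_FW p k s0 : \forall t \near s0,
  \dim (hfil V p t :&: cW k t) = \dim (hfil V p s0 :&: cW k s0).
Proof.
have base j : \dim (cW j s0) = 0%N -> \forall t \near s0,
    \dim (hfil V p t :&: cW j t) = \dim (hfil V p s0 :&: cW j s0).
  move=> d0; apply: filterS (dim_cW j s0) => t; rewrite d0 => dt.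
  have z s : \dim (cW j s) = 0%N -> \dim (hfil V p s :&: cW j s) = 0%N.
    move=> E; apply/eqP; rewrite -leqn0.
    by apply: leq_trans (dimvS (capvSr _ _)) _; rewrite E.
  by rewrite !z.
have [a [_ [Wa _]]] := wfil_finite V s0.
have [ka|ak] := leP k a.
  apply: base; apply/eqP; rewrite -leqn0.
  apply: leq_trans (dimvS (complexifyS R (wfilS s0 ka))) _.
  by rewrite Wa complexify0 dimv0.
have -> : k = a + `|k - a|%N%:Z by lia.
elim: `|k - a|%N => [|N IH].
  by apply: base; rewrite addr0 /cW Wa complexify0 dimv0.
set j := a + N.+1%:Z; have j1 : a + N%:Z = j - 1 by rewrite /j; lia.
rewrite j1 in IH.
have [hg _ _ _ _] := gr_polarized_vhs V j.
have E t : (\dim (gr_filtration (hfil V ^~ t) (wfil V ^~ t) j p)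
     + \dim (hfil V p t :&: cW (j - 1) t) =
   \dim (hfil V p t :&: cW j t) + \dim (cW (j - 1) t))%N.
  rewrite -dimv_sum_cap -capvA; congr (_ + \dim (_ :&: _))%N.
  apply/esym/capv_idPr; apply: complexifyS; apply: wfilS; lia.
apply: filterS3 (subbundle_dim s0 (hg p)) IH (dim_cW (j - 1) s0) => t d1 d2 d3.
by apply/eqP; rewrite -(eqn_add2r (\dim (cW (j - 1) t))) -E d1 d2 E d3.
Qed.

(** Phi_p is a complement of F^(p+1). *)
Lemma dim_Phi p s0 : \forall t \near s0, \dim (PhiF p t) = \dim (PhiF p s0).
Proof.
have E t : (\dim (hfil V (p + 1) t) + \dim (PhiF p t) = lrank ls t)%N.
  have [h1 h2] := F_Phi_direct (hI t) p.
  by rewrite -(dimv_disjoint_sum h1) h2 dim_row_space.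
apply: filterS2 (subbundle_dim s0 (hfil_holomorphic V (p + 1))) (near_lrank s0) => t d r.
by apply/eqP; rewrite -(eqn_add2l (\dim (hfil V (p + 1) t))) E d E r.
Qed.

Lemma dim_U p s0 : \forall t \near s0, \dim (UF p t) = \dim (UF p s0).
Proof.
have E t : (lrank ls t + \dim (UF p t) = \dim (hfil V p t) + \dim (PhiF p t))%N.
  rewrite -dimv_sum_cap (F_add_Phi (hI t)) dim_row_space; congr (_ + \dim _)%N.
  exact: (UspaceE (hI t)).
have dF := subbundle_dim s0 (hfil_holomorphic V p).
apply: filterS3 dF (dim_Phi p s0) (near_lrank s0) => t d1 d2 r.
by apply/eqP; rewrite -(eqn_add2l (lrank ls t)) E d1 d2 -E r.
Qed.

Lemma dim_Uc p s0 : \forall t \near s0, \dim (UcF p t) = \dim (UcF p s0).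
Proof.
have E t : (\dim (UF p t) + \dim (UcF p t) = lrank ls t)%N.
  have [h1 h2] := Ucompl_direct (hI t) p.
  by rewrite -(dimv_disjoint_sum h1) h2 dim_row_space.
apply: filterS2 (dim_U p s0) (near_lrank s0) => t d r.
by apply/eqP; rewrite -(eqn_add2l (\dim (UF p t))) E d E r.
Qed.

(** * Local sections of F, W and Phi *)

Lemma frame_cW k s0 :
  frame_of M s0 (fun=> seq_mx (vbasis (cW k s0))) (loc s0 (cW k)).
Proof.
split; first exact: smooth_mx_cst.
- apply: row_free_seq_mx; exact: basis_free (vbasisP _).
- apply: filterS (loc_flat R s0 (@wfil_flat _ _ _ V k)) => t E u.
  by rewrite /cW E memv_vbasis.
Qed.

(** Flat sections span W and have zero derivatives. *)
Lemma spanned_cW k s0 : spanned M s0 (loc s0 (cW k)) (cW k s0) (cW k s0).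
Proof.
move=> u; rewrite loc_refl => uW; exists (fun=> u); split => //.
- exact: smooth_mx_cst.
- by apply: filterS (loc_flat R s0 (@wfil_flat _ _ _ V k)) => t E; rewrite /cW E.
- by move=> c v cs; rewrite d10_cst d01_cst !mem0v.
Qed.

(** In a holomorphic frame the (0,1)-derivatives vanish, and transversality bounds the
    remaining ones. *)
Lemma frame_F p s0 : exists m (A : S -> 'M[C]_(m, lrank ls s0)),
  frame_of M s0 A (loc s0 (hfil V p)) /\
  forall c (v : 'rV[C]_(cdim c)), cdom c s0 ->
    d01 v A s0 = 0 /\ forall i, row i (dmx v A s0) \in hfil V (p - 1) s0.
Proof.
have [N [m [e [oN Ns he eB]]]] := hfil_holomorphic V p s0.
have hs i : smooth_section M N (e i) by move=> c s j; have [] := he i c s j.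
exists m, (fun t => \matrix_(i, j) triv s0 (e i) t 0 j); split.
  exact: (frame_of_sections oN Ns hs eB).
move=> c v cs; split.
  apply/matrixP => i j; rewrite !mxE.
  have -> : (fun t => (\matrix_(i, j) triv s0 (e i) t 0 j) i j) =
      (fun t => triv s0 (e i) t 0 j).
    by apply/funext => t; rewrite mxE.
  have [_ h] := he i c s0 j.
  apply: (h (Defs.coord c s0) v).
  by apply: imageP; split; [split|exact: lnbhd_refl].
move=> i; rewrite row_dmx.
have -> : (fun t => row i (\matrix_(i0, j) triv s0 (e i0) t 0 j)) = triv s0 (e i).
  by apply/funext => t; apply/rowP => j; rewrite !mxE.
rewrite -nablaE.
have eF s : N s -> e i s \in hfil V p s.
  by move=> /eB b; apply: (basis_mem b); apply: map_f; exact: mem_enum.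
have [_ _ _ h] := @hfil_transverse _ _ _ V p N (e i) oN (he i) eF.
exact: h.
Qed.

Lemma spanned_F p s0 :
  spanned M s0 (loc s0 (hfil V p)) (hfil V (p - 1) s0) (hfil V p s0).
Proof.
have [m [A [[hA fA AB] dA]]] := frame_F p s0.
move=> u; rewrite (nbhs_singleton AB) => /submxP[x ->].
have hx := smooth_mx_cst M s0 x.
exists (fun t => x *m A t); split => //.
- exact: (smooth_mxM hx hA).
- by apply: filterS AB => t ->; exact: submxMl.
- move=> c v cs; have [d0 dF] := dA c v cs.
  rewrite (d10M v cs hx hA) (d01M v cs hx hA) d10_cst d01_cst.
  rewrite !mul0mx !add0r d0 mulmx0 mem0v.
  split => //; apply: memv_mulmx => i; have := dF i.
  by rewrite d10_d01 d0 add0r.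
Qed.

Lemma deriv_F p s0 (sigma : S -> 'rV[C]_(lrank ls s0)) : smooth_mx M s0 sigma ->
  (\forall t \near s0, sigma t \in loc s0 (hfil V p) t) ->
  forall c (v : 'rV[C]_(cdim c)), cdom c s0 ->
  d10 v sigma s0 \in hfil V (p - 1) s0 /\ d01 v sigma s0 \in hfil V p s0.
Proof.
apply: (section_deriv (@spanned_F p s0)).
- apply: dim_near_loc; exact: subbundle_dim (hfil_holomorphic V p).
- rewrite loc_refl; have := hfil_decreasing V (p - 1) s0; rewrite subrK; exact.
- by rewrite loc_refl.
Qed.

(** The extension comes from the local constancy of the rank; as the section lies in
    both families, the constraints of F and of W on its derivatives both apply. *)
Lemma FW_extends p k s0 u : u \in hfil V p s0 -> u \in cW k s0 ->
  exists e : S -> 'rV[C]_(lrank ls s0), [/\ smooth_mx M s0 e, e s0 = u,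
    \forall t \near s0, e t \in loc s0 (fun s => hfil V p s :&: cW k s)%VS t &
    forall c (v : 'rV[C]_(cdim c)), cdom c s0 ->
    [/\ d10 v e s0 \in hfil V (p - 1) s0, d10 v e s0 \in cW k s0,
     d01 v e s0 \in hfil V p s0 & d01 v e s0 \in cW k s0]].
Proof.
move=> uF uW; have [m [A [fA _]]] := frame_F p s0.
have dFW := dim_near_loc (dim_FW p k s0).
have lc := near_lnbhd_refl ls s0.
have [||e [he es eB]] := extends_cap fA (frame_cW k s0) _ (u := u).
- apply: filterS2 dFW lc => t d h.
  by rewrite -!loc_cap //; exact: lnbhd_refl.
- by rewrite memv_cap !loc_refl uF.
have eF : \forall t \near s0, e t \in loc s0 (hfil V p) t.
  by apply: filterS eB => t; rewrite memv_cap => /andP[].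
have eW : \forall t \near s0, e t \in loc s0 (cW k) t.
  by apply: filterS eB => t; rewrite memv_cap => /andP[].
exists e; split => //.
  by apply: filterS2 eB lc => t et h; rewrite loc_cap.
move=> c v cs; have [h1 h2] := deriv_F he eF v cs.
have dW := dim_near_loc (dim_cW k s0).
have [||h3 h4] := section_deriv (@spanned_cW k s0) dW _ _ he eW v cs.
- by rewrite loc_refl.
- by rewrite loc_refl.
by split.
Qed.

(** The generators of Phi_p in [Phi_ind] extend to conjugates of sections of
    F^r \cap W_k, whose derivatives of type (1,0) and (0,1) are conjugate to the
    (0,1)- and (1,0)-derivatives of the latter: they lie in the conjugates of
    F^r \cap W_k and of F^(r-1) \cap W_k. *)
Lemma spanned_Phi p s0 :
  spanned M s0 (loc s0 (PhiF p)) (PhiF p s0) (PhiF (p + 1) s0).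
Proof.
move=> u; rewrite loc_refl.
apply: (Phi_ind (hI s0)); first exact: extends0.
  by move=> x y; exact: extendsD.
move=> r k w krp wF wW; have [e [he es eB de]] := FW_extends wF wW.
exists (fun t => cmx (e t)); split.
- exact: smooth_mx_conj.
- by rewrite es.
- apply: filterS2 eB (near_lnbhd_refl ls s0) => t /mem_locP[x + ->] h.
  rewrite memv_cap => /andP[xF xW]; rewrite cmx_transport mem_loc_transport //.
  by apply: (subvP (PhiS (hI t) krp)); exact: (conj_FW_Phi (hI t)).
- move=> c v cs; have [e1 e2 e3 e4] := de c v cs.
  rewrite (d10_conj v cs he) (d01_conj v cs he); split.
    by apply: (subvP (PhiS (hI s0) krp)); exact: (conj_FW_Phi (hI s0) e3 e4).
  apply: (subvP (@PhiS _ _ _ _ _ (hI s0) (k - (r - 1)) (p + 1) _)); first by lia.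
  exact: (conj_FW_Phi (hI s0) e1 e2).
Qed.
End Filtrations.

(** * Frames and projections of the decomposition *)

Section Decomposition.
Variables (R : realType) (S : topologicalType) (M : complex_manifold R S).
Variable (V : gp_vmhs M).
Local Notation C := (Cx R).
Local Notation ls := (vls V).
Variable I : forall s, int * int -> {vspace 'rV[C]_(lrank ls s)}.
Hypothesis hI : forall s,
  deligne_bigrading (fun p => hfil V p s) (fun k => wfil V k s) (I s).
Implicit Types (s t : S) (c : chart M) (p k : int) (B : Cfamily R ls).
Local Notation PhiF := (PhiF I).
Local Notation UF := (UF I).
Local Notation UcF := (UcF I).

Lemma frame_U p s0 : exists m (A : S -> 'M[C]_(m, lrank ls s0)),
  frame_of M s0 A (loc s0 (UF p)).
Proof.
have lc := near_lnbhd_refl ls s0.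
have UE t : UF p t = (hfil V p t :&: PhiF p t)%VS by exact: (UspaceE (hI t)).
have LE t : lnbhd ls s0 t ->
    loc s0 (UF p) t = (loc s0 (hfil V p) t :&: loc s0 (PhiF p) t)%VS.
  by move=> h; rewrite -(loc_cap _ _ h) /loc UE.
have sU : spanned M s0 (loc s0 (UF p)) fullv fullv.
  move=> u uU; have [m [A [fA _]]] := frame_F V p s0.
  have sP := spanned_Phi hI (p := p) (s0 := s0).
  have [A' [fA' _]] := spanned_frame sP (dim_near_loc (dim_Phi hI p s0)).
  have dd : \forall t \near s0, \dim (loc s0 (hfil V p) t :&: loc s0 (PhiF p) t) =
      \dim (loc s0 (hfil V p) s0 :&: loc s0 (PhiF p) s0).
    apply: filterS2 (dim_near_loc (dim_U hI p s0)) lc => t d h.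
    by rewrite -!LE //; exact: lnbhd_refl.
  have u' : u \in (loc s0 (hfil V p) s0 :&: loc s0 (PhiF p) s0)%VS.
    by rewrite -LE //; exact: lnbhd_refl.
  have [e [he es eB]] := extends_cap fA fA' dd u'.
  exists e; split => //; first by apply: filterS2 eB lc => t et h; rewrite LE.
  by move=> c v cs; rewrite !memvf.
have [A [fA _]] := spanned_frame sU (dim_near_loc (dim_U hI p s0)).
by exists (\dim (loc s0 (UF p) s0)), A.
Qed.

Lemma frame_Uc p s0 : exists m (A : S -> 'M[C]_(m, lrank ls s0)),
  frame_of M s0 A (loc s0 (UcF p)).
Proof.
have sU : spanned M s0 (loc s0 (UcF p)) fullv fullv.
  move=> u; rewrite loc_refl => /memv_addP[x xF [y yP ->]].
  apply: extendsD.
    have := @spanned_F _ _ _ V (p + 1) s0 x; rewrite loc_refl => /(_ xF).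
    by apply: extends_sub; apply: nearW => t; apply: locS; exact: addvSl.
  have := spanned_Phi hI (p := p - 1) (s0 := s0) (u := y); rewrite loc_refl => /(_ yP).
  by apply: extends_sub; apply: nearW => t; apply: locS; exact: addvSr.
have [A [fA _]] := spanned_frame sU (dim_near_loc (dim_Uc hI p s0)).
by exists (\dim (loc s0 (UcF p) s0)), A.
Qed.

Definition piU p s : 'End('rV[C]_(lrank ls s)) := daddv_pi (UF p s) (UcF p s).

Lemma smooth_piU p s (sigma : bsection R ls) : smooth_mx M s (triv s sigma) ->
  smooth_mx M s (triv s (fun t => piU p t (sigma t))).
Proof.
have [m1 [A1 f1]] := frame_U p s; have [m2 [A2 f2]] := frame_Uc p s.
apply: (smooth_projection f1 f2) => t; by have [] := Ucompl_direct (hI t) p.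
Qed.

Lemma piU_add p q s u : p != q -> u \in (UF p s + UF q s)%VS ->
  u = piU p s u + piU q s u.
Proof.
move=> pq; have [h1 _] := Ucompl_direct (hI s) p; have [h2 _] := Ucompl_direct (hI s) q.
have s2 := Uspace_sub_Ucompl (hI s) pq; rewrite eq_sym in pq.
exact: (daddv_pi_split h1 h2 (Uspace_sub_Ucompl (hI s) pq) s2).
Qed.

(** * Types of the connection *)

(** U^p is contained in F^p and in Phi_p; the two constraints on the derivatives
    intersect in two consecutive summands. *)
Lemma deriv_U p s (sigma : S -> 'rV[C]_(lrank ls s)) : smooth_mx M s sigma ->
  (\forall t \near s, sigma t \in loc s (UF p) t) ->
  forall c (v : 'rV[C]_(cdim c)), cdom c s ->
  d10 v sigma s \in (UF (p - 1) s + UF p s)%VS /\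
  d01 v sigma s \in (UF p s + UF (p + 1) s)%VS.
Proof.
move=> hs sU c v cs.
have UE t : UF p t = (hfil V p t :&: PhiF p t)%VS by exact: (UspaceE (hI t)).
have sF : \forall t \near s, sigma t \in loc s (hfil V p) t.
  by apply: filterS sU => t; apply: subvP; apply: locS; rewrite UE capvSl.
have sP : \forall t \near s, sigma t \in loc s (PhiF p) t.
  by apply: filterS sU => t; apply: subvP; apply: locS; rewrite UE capvSr.
have [a1 a2] := deriv_F hs sF v cs.
have P1 : (loc s (PhiF p) s <= PhiF p s)%VS by rewrite loc_refl.
have P2 : (loc s (PhiF p) s <= PhiF (p + 1) s)%VS.
  by rewrite loc_refl; apply: (PhiS (hI s)); lia.
have [b1 b2] := section_deriv (spanned_Phi hI (p := p) (s0 := s))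
  (dim_near_loc (dim_Phi hI p s)) P1 P2 hs sP v cs.
have E1 := F_cap_Phi (hI s) (p - 1); rewrite subrK in E1.
have E2 := F_cap_Phi (hI s) p.
split.
  by have := memv_cap (d10 v sigma s) (hfil V (p - 1) s) (PhiF p s); rewrite E1 a1 b1.
by have := memv_cap (d01 v sigma s) (hfil V p s) (PhiF (p + 1) s); rewrite E2 a2 b2.
Qed.

(** The two types of the connection, before projection to the summands. *)
Definition nabla10 (sigma : bsection R ls) : one_form M ls := fun c s v =>
  2^-1 *: (nabla sigma s v - 'i *: nabla sigma s ('i *: v)).
Definition nabla01 (sigma : bsection R ls) : one_form M ls := fun c s v =>
  2^-1 *: (nabla sigma s v + 'i *: nabla sigma s ('i *: v)).

Lemma nabla10E sigma c s (v : 'rV[C]_(cdim c)) : nabla10 sigma s v = d10 v (triv s sigma) s.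
Proof. by rewrite /nabla10 !nablaE. Qed.
Lemma nabla01E sigma c s (v : 'rV[C]_(cdim c)) : nabla01 sigma s v = d01 v (triv s sigma) s.
Proof. by rewrite /nabla01 !nablaE. Qed.
End Decomposition.

(** * The four forms *)

Section TypeLinearity.
Variables (R : realType) (S : topologicalType) (M : complex_manifold R S).
Local Notation C := (Cx R).
Local Notation ofR t := (((t : R)%:C)%C : Cx R).
Variables (m n : nat) (A : S -> 'M[C]_(m, n)) (s : S) (c : chart M).
Hypotheses (cs : cdom c s) (hA : smooth_mx M s A).
Implicit Types (u v : 'rV[C]_(cdim c)) (a : C).

Lemma dmx_ii v : dmx ('i *: ('i *: v)) A s = - dmx v A s.
Proof.
have -> : 'i *: ('i *: v) = ofR (-1) *: v by rewrite scalerA -expr2 sqrCi ofRN.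
by rewrite dmxZv // ofRN scaleN1r.
Qed.

Lemma d10_i v : d10 ('i *: v) A s = 'i *: d10 v A s.
Proof.
rewrite /d10 dmx_ii [RHS]scalerA mulrC -scalerA; congr (_ *: _).
by rewrite scalerBr scalerA -expr2 sqrCi scalerN opprK scaleN1r opprK addrC.
Qed.

Lemma d01_i v : d01 ('i *: v) A s = - 'i *: d01 v A s.
Proof.
rewrite /d01 dmx_ii [RHS]scalerA mulrC -scalerA; congr (_ *: _).
by rewrite scalerDr scalerA mulNr -expr2 sqrCi opprK scale1r scalerN scaleNr addrC.
Qed.

(** Linearity and antilinearity over C follow from linearity over R and from the
    behaviour under multiplication of the direction by i. *)
Lemma d10_semilinear a u v : d10 (a *: u + v) A s = a *: d10 u A s + d10 v A s.
Proof.
have dD (x y : 'rV[C]_(cdim c)) : d10 (x + y) A s = d10 x A s + d10 y A s.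
  by rewrite /d10 (scalerDr 'i x) !dmxDv // (scalerDr 'i) opprD -[RHS]scalerDr addrACA.
have dZ (r : R) (x : 'rV[C]_(cdim c)) : d10 (ofR r *: x) A s = ofR r *: d10 x A s.
  have -> : d10 (ofR r *: x) A s =
      2^-1 *: (dmx (ofR r *: x) A s - 'i *: dmx (ofR r *: ('i *: x)) A s).
    by rewrite /d10 !scalerA (mulrC 'i).
  rewrite !dmxZv // [RHS]scalerA mulrC -scalerA; congr (_ *: _).
  by rewrite scalerBr !scalerA (mulrC 'i).
rewrite dD; congr (_ + _); rewrite (complex_split a) !scalerDl dD dZ.
by rewrite -!scalerA d10_i dZ.
Qed.

Lemma d01_semilinear a u v : d01 (a *: u + v) A s = a^* *: d01 u A s + d01 v A s.
Proof.
have dD (x y : 'rV[C]_(cdim c)) : d01 (x + y) A s = d01 x A s + d01 y A s.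
  by rewrite /d01 (scalerDr 'i x) !dmxDv // (scalerDr 'i) -[RHS]scalerDr addrACA.
have dZ (r : R) (x : 'rV[C]_(cdim c)) : d01 (ofR r *: x) A s = ofR r *: d01 x A s.
  have -> : d01 (ofR r *: x) A s =
      2^-1 *: (dmx (ofR r *: x) A s + 'i *: dmx (ofR r *: ('i *: x)) A s).
    by rewrite /d01 !scalerA (mulrC 'i).
  rewrite !dmxZv // [RHS]scalerA mulrC -scalerA; congr (_ *: _).
  by rewrite scalerDr !scalerA (mulrC 'i).
have aE : a^* = ofR (complex.Re a) + - 'i * ofR (complex.Im a).
  rewrite {1}(complex_split a) rmorphD rmorphM /= conjCi.
  by congr (_ + - 'i * _); exact: conjc_real.
rewrite dD; congr (_ + _); rewrite {1}(complex_split a) aE !scalerDl dD dZ.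
by rewrite -!scalerA d01_i dZ.
Qed.

Lemma d10_transition c' v : cdom c' s ->
  d10 (tangent_transition c' s v) A s = d10 v A s.
Proof. by move=> cs'; rewrite /d10 -(tangent_transition_i v cs cs') !dmx_transition. Qed.

Lemma d01_transition c' v : cdom c' s ->
  d01 (tangent_transition c' s v) A s = d01 v A s.
Proof. by move=> cs'; rewrite /d01 -(tangent_transition_i v cs cs') !dmx_transition. Qed.

Lemma smooth_mx_d10 v : smooth_mx M s (d10 v A).
Proof.
rewrite /d10 (_ : (fun s => _) =
  fun s => 2^-1 *: (dmx v A s + (- 'i) *: dmx ('i *: v) A s)).
  by apply: smooth_mxZ; apply: smooth_mxD; [|apply: smooth_mxZ]; exact: smooth_mx_dmx.
by apply/funext => t; rewrite scaleNr.
Qed.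

Lemma smooth_mx_d01 v : smooth_mx M s (d01 v A).
Proof.
by apply: smooth_mxZ; apply: smooth_mxD; [|apply: smooth_mxZ]; exact: smooth_mx_dmx.
Qed.
End TypeLinearity.

Section Forms.
Variables (R : realType) (S : topologicalType) (M : complex_manifold R S).
Variable (V : gp_vmhs M).
Local Notation C := (Cx R).
Local Notation ls := (vls V).
Variable I : forall s, int * int -> {vspace 'rV[C]_(lrank ls s)}.
Hypothesis hI : forall s,
  deligne_bigrading (fun p => hfil V p s) (fun k => wfil V k s) (I s).
Implicit Types (s t : S) (c : chart M) (p k : int) (sigma : bsection R ls).
Local Notation UF := (UF I).
Local Notation piU := (piU I).

Lemma nabla_types_near sigma c s (v : 'rV[C]_(cdim c)) : cdom c s ->
  (\forall t \near s, smooth_mx M t (triv t sigma)) ->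
  \forall t \near s, triv s (fun t => nabla10 sigma t v) t = d10 v (triv s sigma) t /\
    triv s (fun t => nabla01 sigma t v) t = d01 v (triv s sigma) t.
Proof.
move=> cs hs; near=> t; have ct : cdom c t by near: t; exact: nbhs_cdom.
have ht : lnbhd ls s t by near: t; exact: near_lnbhd_refl.
have hst : smooth_mx M t (triv t sigma) by near: t.
rewrite /triv /nabla10 /nabla01 -!scalemxAl mulmxBl mulmxDl -!scalemxAl.
by rewrite !(nabla_transport _ ct ht hst).
Unshelve. all: by end_near. Qed.

Lemma form_of_type (N : one_form M ls) (tau : C -> C) p (O : set S) : open O ->
  (forall c c' s v, O s -> cdom c s -> cdom c' s ->
     N c' s (tangent_transition c' s v) = N c s v) ->
  (forall c s a u v, O s -> cdom c s -> N c s (a *: u + v) = tau a *: N c s u + N c s v) ->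
  (forall c s v, O s -> cdom c s -> smooth_mx M s (triv s (fun t => N c t v))) ->
  form_in tau (@smooth_section R S M ls) O (UF p) (fun c s v => piU p s (N c s v)).
Proof.
move=> oO h1 h2 h3; split.
- by move=> c c' s v Os cs cs'; rewrite h1.
- by move=> c s a u v Os cs; rewrite h2 // linearP.
- move=> c v; apply/smooth_sectionP; first by apply: openI => //; exact: cdom_open.
  by move=> s [Os cs]; apply: (smooth_piU hI); exact: h3.
- by move=> c s v _ _; exact: memv_pi.
Qed.

Lemma nabla10_form sigma p (O : set S) : open O -> smooth_section M O sigma ->
  form10 O (UF p) (fun c s v => piU p s (nabla10 (M := M) sigma s v)).
Proof.
move=> oO /(smooth_sectionP M _ oO) hs; apply: (form_of_type p oO).
- by move=> c c' s v Os cs cs'; rewrite !nabla10E (d10_transition cs (hs s Os)).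
- by move=> c s a u v Os cs; rewrite !nabla10E (d10_semilinear cs (hs s Os)).
- move=> c s v Os cs.
  apply: smooth_mx_eq (smooth_mx_d10 cs (hs s Os) v).
  have hn : \forall t \near s, smooth_mx M t (triv t sigma).
    by apply: filterS hs _; apply: open_nbhs_nbhs.
  by apply: filterS (nabla_types_near v cs hn) => t [].
Qed.

Lemma nabla01_form sigma p (O : set S) : open O -> smooth_section M O sigma ->
  form01 O (UF p) (fun c s v => piU p s (nabla01 (M := M) sigma s v)).
Proof.
move=> oO /(smooth_sectionP M _ oO) hs; apply: (form_of_type p oO).
- by move=> c c' s v Os cs cs'; rewrite !nabla01E (d01_transition cs (hs s Os)).
- by move=> c s a u v Os cs; rewrite !nabla01E (d01_semilinear cs (hs s Os)).
- move=> c s v Os cs.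
  apply: smooth_mx_eq (smooth_mx_d01 cs (hs s Os) v).
  have hn : \forall t \near s, smooth_mx M t (triv t sigma).
    by apply: filterS hs _; apply: open_nbhs_nbhs.
  by apply: filterS (nabla_types_near v cs hn) => t [].
Qed.

Lemma nabla_split p (O : set S) sigma c s (v : 'rV[C]_(cdim c)) :
  open O -> smooth_section M O sigma -> (forall t, O t -> sigma t \in UF p t) ->
  O s -> cdom c s ->
  nabla sigma s v = piU (p + 1) s (nabla01 sigma s v) + piU p s (nabla01 sigma s v)
    + piU p s (nabla10 sigma s v) + piU (p - 1) s (nabla10 sigma s v).
Proof.
move=> oO hO sU Os cs.
have hs : smooth_mx M s (triv s sigma) by move/(smooth_sectionP M _ oO): hO; exact.
have nU : \forall t \near s, triv s sigma t \in loc s (UF p) t.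
  have : nbhs s O by exact: open_nbhs_nbhs.
  by apply: filterS2 (near_lnbhd_refl ls s) => t h /sU; rewrite /triv mem_loc_transport.
have [] := deriv_U hI hs nU v cs; rewrite -nabla10E -nabla01E => U10 U01.
have p1 : p != p + 1 by lia.
have p2 : p - 1 != p by lia.
have E01 := piU_add hI p1 U01; have E10 := piU_add hI p2 U10.
rewrite -addrA [X in X + _]addrC -E01 [X in _ + X]addrC -E10.
by rewrite nabla10E nabla01E nablaE d10_d01.
Qed.
End Forms.

Theorem theorem5p1 (R : realType) (S : topologicalType)
    (M : complex_manifold R S) (V : gp_vmhs M)
    (I : forall s, int * int -> {vspace 'rV[Cx R]_(lrank (vls V) s)})
    (hI : forall s,
      deligne_bigrading (fun p => hfil V p s) (fun k => wfil V k s) (I s)) :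
  complex_vhs M (V := vls V)
    (fun p s => sum_over [set: int] (fun q => I s (p, q))).
Proof.
split.
- move=> p; apply: smooth_subbundle_frames => s0; exact: (frame_U hI p s0).
- by move=> s; exact: (Uspace_direct (hI s)).
move=> p O sigma oO hs sU.
exists (fun c s v => piU I (p + 1) s (nabla01 sigma s v)),
  (fun c s v => piU I p s (nabla01 sigma s v)),
  (fun c s v => piU I p s (nabla10 sigma s v)),
  (fun c s v => piU I (p - 1) s (nabla10 sigma s v)).
split.
- exact: (nabla01_form hI).
- exact: (nabla01_form hI).
- exact: (nabla10_form hI).
- exact: (nabla10_form hI).
- by move=> c s v Os cs; exact: (nabla_split hI v oO hs sU Os cs).
Qed.
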